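(* Let $p\colon E\to B$ be a weak fibration, and let $(X,A)$ be a pair of a cubical complex and its subcomplex. Suppose there are a tame map $f\colon X\to E$ and tame homotopies $h\colon A\times I\to E$, $k\colon X\times I\to B$ satisfying $h_0=f|A$, $k_0=p\circ f$, and $p\circ h=k|A\times I$. Then there exists a tame homotopy $H\colon X\times I\to E$ satisfying $H_0=f$, $H|A\times I=h$, and $p\circ H=k$.
   Context: All spaces are diffeological spaces and maps are smooth maps; $I=[0,1]$, $I^n$ and their subsets have the subspace diffeology from $\mathbf{R}^n$, and products the product diffeology. For a homotopy $h$, $h_t=h(\cdot,t)$. Let $K$ be a cubical subcomplex of $I^n$ (a union of faces), and $0<\epsilon\le1/2$. A smooth map $f\colon K\to Y$ is $\epsilon$-tame if $f(t_1,\dots,t_j,\dots,t_n)=f(t_1,\dots,t_{j-1},\alpha,t_{j+1},\dots,t_n)$ for all $(t_1,\dots,t_n)\in K$, all $j$ and all $\alpha\in\{0,1\}$ with $|t_j-\alpha|\le\epsilon$. It is tame if it is $\epsilon$-tame for some $\epsilon>0$. For $n\ge1$ let $L^{n-1}=\partial I^{n-1}\times I\cup I^{n-1}\times\{0\}\subset I^n$. A smooth map $p\colon E\to B$ is a weak fibration if for every $n\geq 1$ and every pair of tame maps $f\colon L^{n-1}\to E$, $g\colon I^n\to B$ with $p\circ f=g|L^{n-1}$ there is a smooth map $G\colon I^n\to E$ with $G|L^{n-1}=f$ and $p\circ G=g$. A cubical complex is a disjoint union of diffeological spaces, each diffeomorphic to a cubical subcomplex of $I^n$ for various $n\ge0$;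 thus it is a union of cubes $X_\lambda\cong I^{n(\lambda)}$, where faces of cubes are cubes of $X$, the intersection of two cubes is a face of each, and each connected component is a union of finitely many cubes. A subcomplex is a union of cubes of the complex. A smooth map $f\colon X\to Y$ from a cubical complex is tame if its restriction $f|X_\lambda$ to each cube is tame. A homotopy $h\colon X\times I\to Y$ between tame maps is tame if its restriction to $X_\lambda\times I\cong I^{n(\lambda)+1}$ is tame for each cube $X_\lambda$. *)

(* Defs.v *)
From HB Require Import structures.
From mathcomp Require Import all_boot all_order all_algebra.
From mathcomp Require Import all_classical all_reals all_analysis.

Set Implicit Arguments.
Unset Strict Implicit.
Unset Printing Implicit Defensive.

Import Order.TTheory GRing.Theory Num.Theory numFieldNormedType.Exports.
Local Open Scope classical_set_scope.
Local Open Scope ring_scope.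

(* Meaningful for [U] open.  Directional derivatives in all directions stand
   for the partial derivatives. *)
Fixpoint Ck (R : realType) (V W : normedModType R) (k : nat) (U : set V)
    (f : V -> W) : Prop :=
  if k is k'.+1 then
    (forall x, U x -> differentiable f x) /\
    (forall v, Ck k' U (fun x => 'D_v f x))
  else forall x, U x -> {for x, continuous f}.

Definition Cinfty (R : realType) (V W : normedModType R) (U : set V)
    (f : V -> W) : Prop := forall k, Ck k U f.

Section Ck_theory.
Variable R : realType.
Implicit Types V W : normedModType R.

Lemma near_eq_differentiable V W (f g : V -> W) (x : V) :
  (\forall y \near x, f y = g y) -> differentiable f x -> differentiable g x.
Proof.
move=> fg df; rewrite -(subrK f g) addrC; apply: differentiableD => //.
set e := g - f.
have e0 : \forall y \near x, e y = 0.
  by apply: filterS fg => y E; rewrite /e/= -[LHS]/(g y - f y) E subrr.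
have ex : e x = 0 by exact: nbhs_singleton e0.
pose L : {linear V -> W} := \0.
have E : e \o shift x = cst (e x) + L +o_ 0 id.
  apply/eqaddoP => _/posnumP[eps]; rewrite ex.
  move: e0; rewrite (near_shift 0) /= subr0; apply: filterS => y ey.
  have -> : (e \o shift x - (cst 0 + (L : V -> W))) y = 0.
    by rewrite -[LHS]/(e (y + x) - (0 + 0)) addr0 subr0.
  by rewrite normr0 mulr_ge0.
have dE : 'd e x = L :> (V -> W).
  by apply: diff_unique => // ?; exact: cst_continuous.
apply/diff_locallyP; rewrite dE; split=> // ?; exact: cst_continuous.
Qed.

Lemma Ck_eq V W k (U : set V) (f g : V -> W) : open U ->
  (forall x, U x -> f x = g x) -> Ck k U f -> Ck k U g.
Proof.
move=> oU; elim: k f g => [|k IH] f g fg /=.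
  move=> cf x Ux; have nU : \forall y \near x, f y = g y.
    by apply: filterS (open_nbhs_nbhs (conj oU Ux)).
  rewrite /prop_for /continuous_at -fg//.
  exact: cvg_trans (near_eq_cvg nU) (cf x Ux).
move=> [df Df].
have nU x : U x -> \forall y \near x, f y = g y.
  by move=> Ux; apply: filterS (open_nbhs_nbhs (conj oU Ux)).
split=> [x Ux|v]; first exact: near_eq_differentiable (nU x Ux) (df x Ux).
apply: IH (Df v) => x Ux; exact: near_eq_derive (nU x Ux).
Qed.

Lemma Ck_sub V W k (U U' : set V) (f : V -> W) : U' `<=` U ->
  Ck k U f -> Ck k U' f.
Proof.
move=> sU; elim: k f => [|k IH] f /= => [cf x /sU /cf //|[df Df]].
by split=> [x /sU /df //|v]; exact: IH.
Qed.

Lemma Ck_pt V W k (U : set V) (f : V -> W) :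
  (forall x, U x -> exists2 U', U' x & Ck k U' f) -> Ck k U f.
Proof.
elim: k f => [|k IH] f /= H; first by move=> x /H[U' U'x]; exact.
split=> [x /H[U' U'x [+ _]]|v]; first exact.
by apply: IH => x /H[U' U'x [_ ?]]; exists U'.
Qed.

Lemma CkW V W k (U : set V) (f : V -> W) : Ck k.+1 U f -> Ck k U f.
Proof.
elim: k f => [|k IH] f [df Df] /=.
  by move=> x Ux; exact/differentiable_continuous/df.
by split=> // v; exact/IH/Df.
Qed.

Lemma Ck_continuous V W k (U : set V) (f : V -> W) : Ck k U f ->
  forall x, U x -> {for x, continuous f}.
Proof. by elim: k f => [|k IH] f // /CkW; exact: IH. Qed.

Lemma Ck_cst V W k (U : set V) (c : W) : Ck k U (cst c : V -> W).
Proof.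
elim: k c => [|k IH] c /=; first by move=> x _; exact: cst_continuous.
split=> // v; rewrite (_ : (fun x => _) = cst 0) //.
by rewrite funeqE => x; rewrite derive_cst.
Qed.

Lemma Ck_id V k (U : set V) : Ck k U (id : V -> V).
Proof.
case: k => [|k] /=; first by move=> x _; exact: cvg_id.
split=> // v; rewrite (_ : (fun x => _) = cst v); first exact: Ck_cst.
by rewrite funeqE => x; rewrite derive_id.
Qed.

Lemma Ck_lin V (W W' : normedModType R) k (U : set V) (f : V -> W)
    (L : {linear W -> W'}) : open U -> continuous L ->
  Ck k U f -> Ck k U (L \o f).
Proof.
move=> oU cL; elim: k f => [|k IH] f /=.
  by move=> cf x Ux; apply: continuous_comp; [exact: cf|exact: cL].
have dL y : differentiable L y by exact: linear_differentiable.
move=> [df Df]; split=> [x Ux|v].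
  exact: differentiable_comp (df x Ux) (dL _).
apply: Ck_eq (IH _ (Df v)) => // x Ux /=.
have dLf := differentiable_comp (df x Ux) (dL _).
by rewrite (deriveE v dLf) (deriveE v (df x Ux)) (diff_comp (df x Ux) (dL _)) diff_lin.
Qed.

Lemma Ck_add V W k (U : set V) (f g : V -> W) : open U ->
  Ck k U f -> Ck k U g -> Ck k U (f + g).
Proof.
move=> oU; elim: k f g => [|k IH] f g /=.
  by move=> cf cg x Ux; apply: continuousD; [exact: cf|exact: cg].
move=> [df Df] [dg Dg]; split=> [x Ux|v].
  by apply: differentiableD; [exact: df|exact: dg].
apply: Ck_eq (IH _ _ (Df v) (Dg v)) => // x Ux.
by rewrite deriveD//; apply/diff_derivable; [exact: df|exact: dg].
Qed.

Lemma Ck_sum V W k (U : set V) n (f : 'I_n -> V -> W) : open U ->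
  (forall i, Ck k U (f i)) -> Ck k U (\sum_(i < n) f i).
Proof.
move=> oU cf; apply: big_ind => //; first exact: Ck_cst.
by move=> ? ? ? ?; exact: Ck_add.
Qed.

Lemma Ck_mul V k (U : set V) (f g : V -> R) : open U ->
  Ck k U f -> Ck k U g -> Ck k U (f * g).
Proof.
move=> oU; elim: k f g => [|k IH] f g.
  by move=> /= cf cg x Ux; apply: continuousM; [exact: cf|exact: cg].
move=> kf kg; have [f' g'] := (CkW kf, CkW kg).
move: kf kg => [df Df] [dg Dg]; split=> [x Ux|v].
  by apply: differentiableM; [exact: df|exact: dg].
apply: Ck_eq (Ck_add oU (IH _ _ f' (Dg v)) (IH _ _ g' (Df v))) => // x Ux.
by rewrite deriveM//; apply/diff_derivable; [exact: df|exact: dg].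
Qed.

Lemma Ck_coord V n k (U : set V) (f : V -> 'rV[R]_n) j : open U ->
  Ck k U f -> Ck k U (fun x => f x 0 j).
Proof.
have clin : linear (fun v : 'rV[R]_n => v 0 j).
  by move=> a u v; rewrite !mxE.
pose LM := GRing.isLinear.Build _ _ _ _ _ clin.
pose L : {linear 'rV[R]_n -> R} := HB.pack (fun v : 'rV[R]_n => v 0 j) LM.
by move=> oU /(Ck_lin (L := L) oU); apply; exact: coord_continuous.
Qed.

Lemma Ck_coordP V n k (U : set V) (f : V -> 'rV[R]_n) : open U ->
  Ck k U f <-> forall j, Ck k U (fun x => f x 0 j).
Proof.
move=> oU; split=> [kf j|kf]; first exact: Ck_coord.
rewrite (_ : f = \sum_(j < n) ((fun x => f x 0 j *: delta_mx 0 j))); last first.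
  rewrite funeqE => x; rewrite fct_sumE [LHS]row_sum_delta.
  by apply: eq_bigr.
apply: Ck_sum => // j; set e := delta_mx 0 j.
have slin : linear (fun a : R => a *: e).
  by move=> a u v; rewrite scalerDl scalerA.
pose LM := GRing.isLinear.Build _ _ _ _ _ slin.
pose L : {linear R -> 'rV[R]_n} := HB.pack (fun a : R => a *: e) LM.
by apply: (Ck_lin (L := L) oU) (kf j) => x; exact: scalel_continuous.
Qed.

Lemma Ck_comp_scalar V n k (U : set 'rV[R]_n) (U' : set V)
    (g : 'rV[R]_n -> R) (h : V -> 'rV[R]_n) : open U' ->
  (forall y, U' y -> U (h y)) ->
  Ck k U g -> Ck k U' h -> Ck k U' (g \o h).
Proof.
move=> oU' hU; elim: k g => [|k IH] g.
  by move=> cg ch x Ux /=; apply: continuous_comp; [exact: ch|exact/cg/hU].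
move=> [dg Dg] kh; have kh' := CkW kh; move: kh => [dh Dh]; split=> [x Ux|v].
  exact: differentiable_comp (dh x Ux) (dg _ (hU _ Ux)).
apply: (@Ck_eq _ _ _ _ (\sum_(j < n) ((fun x => ('D_v h x) 0 j) *
    ((fun y => 'D_(delta_mx 0 j) g y) \o h)))) => //.
  move=> x Ux; rewrite fct_sumE.
  have dgx : differentiable g (h x) by exact/dg/hU.
  have dhx : differentiable h x by exact: dh.
  rewrite [RHS]deriveE; last exact: differentiable_comp.
  rewrite diff_comp//= -(deriveE v dhx) [X in _ = 'd g _ X]row_sum_delta.
  rewrite linear_sum; apply: eq_bigr => j _ /=.
  by rewrite linearZ/= -deriveE.
apply: Ck_sum => // j.
exact: Ck_mul oU' (Ck_coord j oU' (Dh v)) (IH _ (Dg _) kh').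
Qed.

Lemma Ck_comp V n m k (U : set 'rV[R]_n) (U' : set V)
    (g : 'rV[R]_n -> 'rV[R]_m) (h : V -> 'rV[R]_n) : open U -> open U' ->
  (forall y, U' y -> U (h y)) ->
  Ck k U g -> Ck k U' h -> Ck k U' (g \o h).
Proof.
move=> oU oU' hU kg kh; apply/Ck_coordP => // j.
exact: (Ck_comp_scalar (g := fun y => g y 0 j) oU' hU (Ck_coord j oU kg) kh).
Qed.

End Ck_theory.

(* A parametrization [U -> X] of an open subset [U] of R^m is represented by a
   total function on R^m, of which only the values on [U] matter
   ([plot_eq]). *)
HB.mixin Record isDiffeological (R : realType) (X : Type) := {
  plot : forall m, set 'rV[R]_m -> ('rV[R]_m -> X) -> Prop ;
  plot_open : forall m (U : set 'rV[R]_m) p, plot m U p -> open U ;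
  plot_eq : forall m (U : set 'rV[R]_m) p q,
    (forall x, U x -> p x = q x) -> plot m U p -> plot m U q ;
  plot_cst : forall m (U : set 'rV[R]_m) (x : X),
    open U -> plot m U (fun=> x) ;
  plot_local : forall m (U : set 'rV[R]_m) p, open U ->
    (forall x, U x -> exists V, [/\ V x, V `<=` U & plot m V p]) -> plot m U p ;
  plot_comp : forall m n (U : set 'rV[R]_m) (V : set 'rV[R]_n) p
      (u : 'rV[R]_n -> 'rV[R]_m),
    plot m U p -> open V -> Cinfty V u -> (forall y, V y -> U (u y)) ->
    plot n V (p \o u) }.

#[short(type="diffeologicalType")]
HB.structure Definition Diffeological (R : realType) :=
  { X of isDiffeological R X }.

Arguments plot {R s m} U p.
Arguments plot_open {R s m U p}.
Arguments plot_eq {R s m U p q}.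
Arguments plot_cst {R s m U}.
Arguments plot_local {R s m U p}.
Arguments plot_comp {R s m n U V p u}.

Definition smooth (R : realType) (X Y : diffeologicalType R) (f : X -> Y) :=
  forall m (U : set 'rV[R]_m) (p : 'rV[R]_m -> X),
    plot U p -> plot U (f \o p).

Definition diffeomorphism (R : realType) (X Y : diffeologicalType R)
    (f : X -> Y) :=
  smooth f /\ exists g : Y -> X, [/\ smooth g, cancel f g & cancel g f].

Section euclidean.
Variables (R : realType) (n : nat).

Definition euclidean_plot m (U : set 'rV[R]_m) (p : 'rV[R]_m -> 'rV[R]_n) :=
  open U /\ Cinfty U p.

Let euclidean_open m (U : set 'rV[R]_m) p : euclidean_plot U p -> open U.
Proof. by case. Qed.

Let euclidean_eq m (U : set 'rV[R]_m) p q :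
  (forall x, U x -> p x = q x) -> euclidean_plot U p -> euclidean_plot U q.
Proof. by move=> pq [oU sp]; split=> // k; exact: Ck_eq (sp k). Qed.

Let euclidean_cst m (U : set 'rV[R]_m) (x : 'rV[R]_n) :
  open U -> euclidean_plot U (fun=> x).
Proof. by move=> oU; split=> // k; exact: Ck_cst. Qed.

Let euclidean_local m (U : set 'rV[R]_m) p : open U ->
  (forall x, U x -> exists V, [/\ V x, V `<=` U & euclidean_plot V p]) ->
  euclidean_plot U p.
Proof.
move=> oU loc; split=> // k; apply: Ck_pt => x /loc[V [Vx _ [_ sp]]].
by exists V.
Qed.

Let euclidean_comp m l (U : set 'rV[R]_m) (V : set 'rV[R]_l) p
    (u : 'rV[R]_l -> 'rV[R]_m) :
  euclidean_plot U p -> open V -> Cinfty V u -> (forall y, V y -> U (u y)) ->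
  euclidean_plot V (p \o u).
Proof.
move=> [oU sp] oV su uVU; split=> // k.
exact: Ck_comp oU oV uVU (sp k) (su k).
Qed.

HB.instance Definition _ := isDiffeological.Build R 'rV[R]_n
  euclidean_open euclidean_eq euclidean_cst euclidean_local euclidean_comp.

End euclidean.

Section real_line.
Variable R : realType.

Definition real_plot m (U : set 'rV[R]_m) (p : 'rV[R]_m -> R) :=
  open U /\ Cinfty U p.

Let real_open m (U : set 'rV[R]_m) p : real_plot U p -> open U.
Proof. by case. Qed.

Let real_eq m (U : set 'rV[R]_m) p q :
  (forall x, U x -> p x = q x) -> real_plot U p -> real_plot U q.
Proof. by move=> pq [oU sp]; split=> // k; exact: Ck_eq (sp k). Qed.

Let real_cst m (U : set 'rV[R]_m) (x : R) : open U -> real_plot U (fun=> x).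
Proof. by move=> oU; split=> // k; exact: Ck_cst. Qed.

Let real_local m (U : set 'rV[R]_m) p : open U ->
  (forall x, U x -> exists V, [/\ V x, V `<=` U & real_plot V p]) ->
  real_plot U p.
Proof.
move=> oU loc; split=> // k; apply: Ck_pt => x /loc[V [Vx _ [_ sp]]].
by exists V.
Qed.

Let real_comp m l (U : set 'rV[R]_m) (V : set 'rV[R]_l) p
    (u : 'rV[R]_l -> 'rV[R]_m) :
  real_plot U p -> open V -> Cinfty V u -> (forall y, V y -> U (u y)) ->
  real_plot V (p \o u).
Proof.
move=> [oU sp] oV su uVU; split=> // k.
exact: Ck_comp_scalar oV uVU (sp k) (su k).
Qed.

#[non_forgetful_inheritance]
HB.instance Definition _ := isDiffeological.Build R (Real.sort R)
  real_open real_eq real_cst real_local real_comp.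

End real_line.

Section subspace.
Variables (R : realType) (X : diffeologicalType R) (A : set X).

Definition sub_plot m (U : set 'rV[R]_m) (p : 'rV[R]_m -> A) :=
  plot U (fun x => val (p x)).

Let sub_open m (U : set 'rV[R]_m) p : sub_plot U p -> open U.
Proof. exact: plot_open. Qed.

Let sub_eq m (U : set 'rV[R]_m) p q :
  (forall x, U x -> p x = q x) -> sub_plot U p -> sub_plot U q.
Proof. by move=> pq; apply: plot_eq => x /pq ->. Qed.

Let sub_cst m (U : set 'rV[R]_m) (x : A) : open U -> sub_plot U (fun=> x).
Proof. exact: plot_cst. Qed.

Let sub_local m (U : set 'rV[R]_m) p : open U ->
  (forall x, U x -> exists V, [/\ V x, V `<=` U & sub_plot V p]) ->
  sub_plot U p.
Proof. exact: plot_local. Qed.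

Let sub_comp m l (U : set 'rV[R]_m) (V : set 'rV[R]_l) p
    (u : 'rV[R]_l -> 'rV[R]_m) :
  sub_plot U p -> open V -> Cinfty V u -> (forall y, V y -> U (u y)) ->
  sub_plot V (p \o u).
Proof. by move=> pp oV su uVU; exact: plot_comp pp oV su uVU. Qed.

HB.instance Definition _ := isDiffeological.Build R (set_type A)
  sub_open sub_eq sub_cst sub_local sub_comp.

End subspace.

Section product.
Variables (R : realType) (X Y : diffeologicalType R).

Definition prod_plot m (U : set 'rV[R]_m) (p : 'rV[R]_m -> X * Y) :=
  plot U (fun x => (p x).1) /\ plot U (fun x => (p x).2).

Let prod_open m (U : set 'rV[R]_m) p : prod_plot U p -> open U.
Proof. by case=> /plot_open. Qed.

Let prod_eq m (U : set 'rV[R]_m) p q :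
  (forall x, U x -> p x = q x) -> prod_plot U p -> prod_plot U q.
Proof.
move=> pq [p1 p2]; split.
  by apply: plot_eq p1 => x /pq ->.
by apply: plot_eq p2 => x /pq ->.
Qed.

Let prod_cst m (U : set 'rV[R]_m) (x : X * Y) :
  open U -> prod_plot U (fun=> x).
Proof. by move=> oU; split; exact: plot_cst. Qed.

Let prod_local m (U : set 'rV[R]_m) p : open U ->
  (forall x, U x -> exists V, [/\ V x, V `<=` U & prod_plot V p]) ->
  prod_plot U p.
Proof.
move=> oU loc; split; apply: plot_local => // x /loc[V [Vx VU []]];
by exists V.
Qed.

Let prod_comp m l (U : set 'rV[R]_m) (V : set 'rV[R]_l) p
    (u : 'rV[R]_l -> 'rV[R]_m) :
  prod_plot U p -> open V -> Cinfty V u -> (forall y, V y -> U (u y)) ->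
  prod_plot V (p \o u).
Proof.
move=> [p1 p2] oV su uVU; split.
  exact: plot_comp p1 oV su uVU.
exact: plot_comp p2 oV su uVU.
Qed.

HB.instance Definition _ := isDiffeological.Build R (X * Y)%type
  prod_open prod_eq prod_cst prod_local prod_comp.

End product.

Definition disjoint_union (R : realType) (J : Type)
  (X : J -> diffeologicalType R) : Type := {i : J & X i}.

Section disjoint_union.
Variables (R : realType) (J : Type) (X : J -> diffeologicalType R).

Definition union_plot m (U : set 'rV[R]_m) (p : 'rV[R]_m -> disjoint_union X) :=
  open U /\ forall x, U x -> exists V (i : J) (q : 'rV[R]_m -> X i),
    [/\ V x, V `<=` U, plot V q & forall y, V y -> p y = existT _ i (q y)].

Let union_open m (U : set 'rV[R]_m) p : union_plot U p -> open U.
Proof. by case. Qed.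

Let union_eq m (U : set 'rV[R]_m) p q :
  (forall x, U x -> p x = q x) -> union_plot U p -> union_plot U q.
Proof.
move=> pq [oU loc]; split=> // x /loc[V [i [r [Vx VU pr E]]]].
by exists V, i, r; split=> // y Vy; rewrite -E// pq//; exact: VU.
Qed.

Let union_cst m (U : set 'rV[R]_m) (x : disjoint_union X) :
  open U -> union_plot U (fun=> x).
Proof.
case: x => i x oU; split=> // y Uy; exists U, i, (fun=> x); split=> //.
exact: plot_cst.
Qed.

Let union_local m (U : set 'rV[R]_m) p : open U ->
  (forall x, U x -> exists V, [/\ V x, V `<=` U & union_plot V p]) ->
  union_plot U p.
Proof.
move=> oU loc; split=> // x /loc[V [Vx VU [oV /(_ x Vx)]]].
move=> [W [i [q [Wx WV pq E]]]]; exists W, i, q; split=> //.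
exact: subset_trans VU.
Qed.

Let union_comp m l (U : set 'rV[R]_m) (V : set 'rV[R]_l) p
    (u : 'rV[R]_l -> 'rV[R]_m) :
  union_plot U p -> open V -> Cinfty V u -> (forall y, V y -> U (u y)) ->
  union_plot V (p \o u).
Proof.
move=> [oU loc] oV su uVU; split=> // y Vy.
have [W [i [q [Wu WU pq E]]]] := loc _ (uVU _ Vy).
have oVW : open (V `&` u @^-1` W).
  rewrite openE => z [Vz Wz]; apply: filterI; first exact: open_nbhs_nbhs.
  apply: (Ck_continuous (su 0%N) Vz).
  by apply: open_nbhs_nbhs; split=> //; exact: plot_open pq.
exists (V `&` u @^-1` W), i, (q \o u); split=> [//|z []//||z [_ /E]//].
apply: (plot_comp pq oVW) => [k|z []//].
by apply: Ck_sub (su k) => z [].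
Qed.

HB.instance Definition _ := isDiffeological.Build R (disjoint_union X)
  union_open union_eq union_cst union_local union_comp.

End disjoint_union.

Definition incl (T : Type) (A B : set T) (AB : A `<=` B) (x : A) : B :=
  SigSub (mem_set (AB _ (set_valP x))).

Section cubes.
Variable R : realType.

Definition unit_interval : set R := [set x | 0 <= x <= 1].

Definition cube n : set 'rV[R]_n := [set x | forall i, 0 <= x 0 i <= 1].
Arguments cube : clear implicits.

Fact unit_interval0 : unit_interval 0.
Proof. by rewrite /unit_interval /= lexx ler01. Qed.

Fact unit_interval1 : unit_interval 1.
Proof. by rewrite /unit_interval /= lexx ler01. Qed.

Definition I0 : unit_interval := SigSub (mem_set unit_interval0).
Definition I1 : unit_interval := SigSub (mem_set unit_interval1).

(* The face of I^n with free coordinates [s 0 < s 1 < ...], the other ones being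
   fixed by [b], parametrized by I^d; the values of [b] on the free coordinates
   are irrelevant. *)
Definition face_map d n (s : 'I_d -> 'I_n) (b : 'I_n -> bool) (t : 'rV[R]_d) :
    'rV[R]_n :=
  \row_i (if [pick k | s k == i] is Some k then t 0 k else (b i)%:R).

Definition is_face n (F : set 'rV[R]_n) :=
  exists d (s : 'I_d -> 'I_n) (b : 'I_n -> bool),
    {homo s : j k / (j < k)%N} /\ F = face_map s b @` cube d.

Definition cubical_subcomplex n (K : set 'rV[R]_n) :=
  exists S : set (set 'rV[R]_n),
    (forall F, S F -> is_face F) /\ K = \bigcup_(F in S) F.

Definition set_coord n (t : 'rV[R]_n) (j : 'I_n) (a : R) : 'rV[R]_n :=
  \row_i (if i == j then a else t 0 i).

(* When [K] is a cubical subcomplex and [e < 1], the point [s] with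
   [val s = set_coord (val t) j a%:R] always exists. *)
Definition eps_tame n (K : set 'rV[R]_n) (Y : diffeologicalType R) (e : R)
    (f : K -> Y) :=
  forall (t s : K) (j : 'I_n) (a : bool), `|val t 0 j - a%:R| <= e ->
    val s = set_coord (val t) j a%:R -> f t = f s.

Definition tame n (K : set 'rV[R]_n) (Y : diffeologicalType R) (f : K -> Y) :=
  smooth f /\ exists e : R, [/\ 0 < e, e <= 2^-1 & eps_tame e f].

(* [open_box m] is the subset
   $\partial I^m \times I \cup I^m \times \{0\}$ of $I^{m+1}$. *)
Definition open_box m : set 'rV[R]_m.+1 :=
  [set x | cube m.+1 x /\
    ((exists (i : 'I_m) (a : bool), x 0 (lift ord_max i) = a%:R) \/
     x 0 ord_max = 0)].
Arguments open_box : clear implicits.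

Fact open_box_cube m : open_box m `<=` cube m.+1.
Proof. by move=> x []. Qed.

Fact cube_init_subproof d (t : cube d.+1) :
  cube d (\row_i val t 0 (lift ord_max i)).
Proof. by move=> i; rewrite mxE; exact: (set_valP t). Qed.

Fact cube_last_subproof d (t : cube d.+1) :
  unit_interval (val t 0 ord_max).
Proof. exact: (set_valP t). Qed.

(* The components of the identification of I^(d+1) with I^d x I. *)
Definition cube_init d (t : cube d.+1) : cube d :=
  SigSub (mem_set (cube_init_subproof t)).

Definition cube_last d (t : cube d.+1) : unit_interval :=
  SigSub (mem_set (cube_last_subproof t)).

End cubes.
Arguments unit_interval : clear implicits.
Arguments cube : clear implicits.
Arguments open_box : clear implicits.
Arguments I0 {R}.
Arguments I1 {R}.

Definition weak_fibration (R : realType) (E B : diffeologicalType R)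
    (p : E -> B) :=
  smooth p /\
  forall m (f : open_box R m -> E) (g : cube R m.+1 -> B),
    tame f -> tame g -> p \o f = g \o incl (@open_box_cube R m) ->
    exists G : cube R m.+1 -> E,
      [/\ smooth G, G \o incl (@open_box_cube R m) = f & p \o G = g].

Record cubicalComplex (R : realType) := CubicalComplex {
  comp_index : Type ;
  comp : comp_index -> diffeologicalType R ;
  comp_dim : comp_index -> nat ;
  comp_model : forall i, set 'rV[R]_(comp_dim i) ;
  comp_modelP : forall i, cubical_subcomplex (@comp_model i) ;
  comp_chart : forall i, comp i -> @comp_model i ;
  comp_chartP : forall i, diffeomorphism (@comp_chart i) }.
Arguments comp_model {R} c i.
Arguments comp_chart {R c} i.

Definition complex_space (R : realType) (X : cubicalComplex R) :
  diffeologicalType R := disjoint_union (@comp R X).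
Coercion complex_space : cubicalComplex >-> diffeologicalType.

Section cubical_complex.
Variables (R : realType) (X : cubicalComplex R).

(* Each cube X_lambda is given by its identification c : I^d -> X_lambda; since
   the chart takes its values in the model, the image of [face_map s b] is then
   a face contained in the model. *)
Definition cells d : set (cube R d -> X) := [set c |
  exists (i : comp_index X) (s : 'I_d -> 'I_(comp_dim i))
      (b : 'I_(comp_dim i) -> bool),
    {homo s : j k / (j < k)%N} /\
    forall t, exists2 x : comp i,
      c t = existT _ i x & val (comp_chart i x) = face_map s b (val t)].

Definition subcomplex (A : set X) :=
  exists S : set (set X),
    (forall F, S F -> exists d (c : cube R d -> X), cells c /\ F = range c) /\
    A = \bigcup_(F in S) F.

(* The cubes of a subcomplex [A] are those of [X] that lie in [A]. *)
Definition subcells (A : set X) d : set (cube R d -> A) :=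
  [set c | cells (fun t => val (c t))].

End cubical_complex.
Arguments cells {R} X d.
Arguments subcells {R X} A d.

Section tame_maps.
Variables (R : realType) (Z Y : diffeologicalType R).
Variable C : forall d, set (cube R d -> Z).

Definition tame_map (f : Z -> Y) :=
  smooth f /\ forall d (c : cube R d -> Z), C c -> tame (f \o c).

Definition tame_homotopy (h : Z * unit_interval R -> Y) :=
  [/\ smooth h,
      tame_map (fun x => h (x, I0)), tame_map (fun x => h (x, I1)) &
      forall d (c : cube R d -> Z), C c ->
        tame (fun t : cube R d.+1 => h (c (cube_init t), cube_last t))].

End tame_maps.

(* Main.v *)
Require Import Defs.
From mathcomp Require Import all_boot all_order all_algebra.
From mathcomp Require Import all_classical all_reals all_analysis.
From mathcomp Require Import ring lra.
Set Implicit Arguments.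
Unset Strict Implicit.
Unset Printing Implicit Defensive.
Import Order.TTheory GRing.Theory Num.Theory numFieldNormedType.Exports.
Local Open Scope classical_set_scope.
Local Open Scope ring_scope.

(** The homotopy is built cube by cube, over the cubes of X not lying in A, in
    order of increasing dimension.  For such a cube F of dimension d, the homotopy
    is already known on the cylinder over the boundary of F, and it is given by f
    on F x {0}; together they are a map on the open box of I^(d+1), compatible
    with k through p, and the weak fibration property extends it to F x I.  Three
    facts make this work in the smooth category.

    - Gluing ([tame_on_faces]): a map on a union of faces that is tame on each
      face is tame, in particular smooth, on the union.  Near a point x, the map
      does not change when the coordinates that are 0 or 1 at x are reset to
      their values at x; so locally it is the composite of a smooth projection
      onto the smallest face containing x with the restriction to that face.
      This gives the smoothness of the map on the open box and of the final
      homotopy.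

    - Taming ([retame_filler]): the filler given by a weak fibration is only
      smooth.  It is precomposed, coordinate by coordinate, with a smooth map
      [squash e] of [0, 1] that is constant near 0 and near 1, is the identity on
      [e, 1 - e] and preserves [0, e] and [1 - e, 1].  The result is tame, and it
      remains a solution, since e-tame maps are invariant under this
      reparametrization ([eps_tame_on_eq]).  The map [squash] comes from the flat
      function exp(-1/x).

    - Induction ([local_extension]): in a model in R^n the faces are indexed by
      the finite type [sig n], and the homotopy is constructed on larger and
      larger sets of faces closed under passing to subfaces ([extend_cell]).

    The charts carry the problem to the models: [component_lift] solves it on each
    component, and the solutions are assembled on the disjoint union.  In the
    models a map on a subset of R^n is represented by a total function on R^n, of
    which only the values on the subset matter. *)

(** * Flat functions and a smooth squashing of the unit interval *)

Section flat_function.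
Variable R : realType.
Implicit Types (n : nat) (x : R).

(** The functions x^(-n) exp(-1/x) for x > 0, extended by 0: a family stable under
    derivation up to linear combinations, hence consisting of smooth functions. *)
Definition flat n x : R := if 0 < x then x ^- n * expR (- x^-1) else 0.

Lemma flat_le0 n x : x <= 0 -> flat n x = 0.
Proof. by rewrite /flat leNgt => /negbTE ->. Qed.

Lemma flat_gt0 n x : 0 < x -> 0 < flat n x.
Proof. by move=> x0; rewrite /flat x0 mulr_gt0 ?expR_gt0// invr_gt0 exprn_gt0. Qed.

Lemma flat_ge0 n x : 0 <= flat n x.
Proof.
by have [/(flat_gt0 n)/ltW//|x0] := ltP 0 x; rewrite flat_le0.
Qed.

Lemma flatS n x : flat n x = x * flat n.+1 x.
Proof.
rewrite /flat; case: ltP => x0; last by rewrite mulr0.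
by rewrite exprS invfM mulrA mulrA divff ?mul1r// gt_eqF.
Qed.

Lemma flat_bounded n x : flat n x <= n%:R ^+ n.
Proof.
have [x0|x0] := ltP 0 x; last by rewrite flat_le0// exprn_ge0.
rewrite /flat x0; case: n => [|n].
  by rewrite !expr0 invr1 mul1r expR_le1 oppr_le0 invr_ge0 ltW.
have nx : 0 < (n.+1%:R : R) by [].
rewrite expRN ler_pdivrMr ?expR_gt0//.
rewrite (_ : x^-1 = n.+1%:R * (n.+1%:R^-1 * x^-1)); last first.
  by rewrite mulrA divff ?mul1r// gt_eqF.
rewrite expRM_natl -exprMn -exprVn.
(* With y = 1/x and N = n + 1, e^y = (e^(y/N))^N >= (y/N)^N. *)
set u := _^-1 * _^-1.
have u0 : 0 <= u by rewrite mulr_ge0 ?invr_ge0 ?ltW.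
apply: lerXn2r.
- by rewrite nnegrE invr_ge0 ltW.
- by rewrite nnegrE mulr_ge0// expR_ge0.
rewrite (_ : x^-1 = n.+1%:R * u); last by rewrite /u mulrA divff ?mul1r// gt_eqF.
by rewrite ler_pM2l// (le_trans _ (expR_ge1Dx _))// lerDr.
Qed.

Lemma flat_is_derive n x :
  is_derive x 1 (flat n) (flat n.+2 x - n%:R * flat n.+1 x).
Proof.
have [x0|x0|<-] := ltgtP 0 x.
- have nx : \forall y \near x, y ^- n * expR (- y^-1) = flat n y.
    near=> y; rewrite /flat ifT//; near: y; exact: lt_nbhsr.
  have xn0 : x != 0 by rewrite gt_eqF.
  apply: near_eq_is_derive nx _ => //.
  have dV : is_derive x 1 (fun y : R => y^-1) (- x ^- 2).
    by apply: is_derive_eq (is_deriveV xn0 (is_derive_id _ _)) _; exact: mulr1.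
  have dX : is_derive x 1 (fun y : R => y ^- n) (- n%:R * x ^- n.+1).
    rewrite (_ : (fun y => _) = (fun y : R => y^-1) ^+ n); last first.
      by apply/funext => y; rewrite fctE/= exprVn.
    apply: is_derive_eq; case: (n) => [|m]; first by rewrite oppr0 !mul0r scale0r.
    rewrite /= mulNr [LHS]mulrN -mulrA; congr (- (_ * _)).
    by rewrite -!exprVn -exprD addn2.
  have dE : is_derive x 1 (fun y => expR (- y^-1)) (x ^- 2 * expR (- x^-1)).
    have := @is_derive1_comp _ expR (fun y => - y^-1) x _ _ _ (is_deriveN dV).
    by rewrite opprK mulrC; apply.
  apply: is_derive_eq (is_deriveM dX dE) _.
  rewrite /flat x0; set e := expR _.
  rewrite !(exprS _ n.+1) !(exprS _ n) -[LHS]/(_ * _ + _ * _); field.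
  by rewrite xn0 expf_neq0.
- have nx : \forall y \near x, cst 0 y = flat n y.
    by near=> y; rewrite flat_le0//; apply: ltW; near: y; exact: lt_nbhsl.
  rewrite !flat_le0 1?ltW// mulr0 subr0.
  by apply: near_eq_is_derive nx _.
- rewrite !flat_le0// mulr0 subr0.
  have D : h^-1 *: (flat n (h *: 1 + 0) - flat n 0) @[h --> 0^'] --> (0 : R).
    (* At 0 the difference quotient is [flat n.+1 h] = h * [flat n.+2 h], and
       [flat n.+2] is bounded. *)
    apply: (@cvg_trans _ (flat n.+1 h @[h --> 0^'])).
      apply: near_eq_cvg; near=> h.
      rewrite addr0 [h *: 1]mulr1 (@flat_le0 n 0)// subr0 (flatS n).
      rewrite [RHS]mulKf//; near: h; exact: nbhs_dnbhs_neq.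
    apply/cvgr0Pnorm_le => e e0; near=> h.
    rewrite flatS normrM [`|flat _ _|]ger0_norm ?flat_ge0//.
    pose C : R := n.+2%:R ^+ n.+2.
    have C0 : 0 < C by rewrite exprn_gt0.
    rewrite (@le_trans _ _ (e / C * C))//; last by rewrite divfK// gt_eqF.
    apply: ler_pM => //; [exact: flat_ge0| |exact: flat_bounded].
    near: h; apply: dnbhs0_le.
    by rewrite divr_gt0// exprn_gt0.
  apply: DeriveDef; first by apply/cvg_ex; exists 0.
  exact/cvg_lim.
Unshelve. all: by end_near. Qed.

End flat_function.

Section smooth_operations.
Variables (R : realType) (V : normedModType R) (U : set V).
Hypothesis oU : open U.
Implicit Types u : V -> R.

Lemma Ck_opp k u : Ck k U u -> Ck k U (fun x => - u x).
Proof.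
have k1 : Ck k U (fun=> -1 : R) by exact: Ck_cst.
move=> /(Ck_mul oU k1); apply: Ck_eq => // x _; exact: mulN1r.
Qed.

Lemma Ck_sub_fun k u v : Ck k U u -> Ck k U v -> Ck k U (fun x => u x - v x).
Proof. by move=> ku /Ck_opp kv; exact: Ck_add. Qed.

Lemma Ck_flat k n u : Ck k U u -> Ck k U (flat n \o u).
Proof.
have df m x : differentiable (flat m : R -> R) x.
  by apply/derivable1_diffP; case: (flat_is_derive m x).
elim: k n u => [|k IH] n u.
  move=> cu x Ux; apply: continuous_comp; first exact: cu.
  exact/differentiable_continuous/df.
move=> ku; have ku' := CkW ku; case: ku => du Du.
split=> [x Ux|v]; first by apply: differentiable_comp; [exact: du|exact: df].
have kn : Ck k U (fun=> - n%:R : R) by exact: Ck_cst.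
have k1 := Ck_add oU (IH n.+2 _ ku') (Ck_mul oU kn (IH n.+1 _ ku')).
apply: Ck_eq (Ck_mul oU (Du v) k1) => // x Ux.
rewrite (deriveE _ (differentiable_comp (du x Ux) (df n _))).
rewrite (diff_comp (du x Ux) (df n _)) /= (diff1E (df n _)) -(deriveE _ (du x Ux)).
rewrite derive1E (@derive_val _ _ _ _ _ _ _ (flat_is_derive n _)) -mulNr.
by [].
Qed.

Lemma Ck_inv k u : (forall x, U x -> u x != 0) -> Ck k U u ->
  Ck k U (fun x => (u x)^-1).
Proof.
move=> u0; elim: k => [|k IH].
  by move=> cu x Ux; apply: continuousV; [exact: u0|exact: cu].
move=> ku; have ki := IH (CkW ku); case: ku => du Du.
split=> [x Ux|v]; first by apply: differentiableV; [exact: du|exact: u0].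
apply: Ck_eq (Ck_opp (Ck_mul oU (Ck_mul oU ki ki) (Du v))) => // x Ux.
rewrite deriveV; [|exact: u0|exact/diff_derivable/du].
by rewrite expr2 invfM -mulNr.
Qed.

End smooth_operations.

Section squashing.
Variable R : realType.
Implicit Types e x : R.

(** A smooth step, equal to 0 up to e/2 and to 1 from e on. *)
Definition step e x : R :=
  flat 0 (x - e / 2) / (flat 0 (x - e / 2) + flat 0 (e - x)).

Lemma step_den_gt0 e x : 0 < e -> 0 < flat 0 (x - e / 2) + flat 0 (e - x).
Proof.
move=> e0; have [xe|xe] := ltP x e.
  by apply: ltr_wpDl; [exact: flat_ge0|apply: flat_gt0; lra].
by apply: ltr_pwDl; [apply: flat_gt0; lra|exact: flat_ge0].
Qed.

Lemma step0 e x : x <= e / 2 -> step e x = 0.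
Proof. by move=> xe; rewrite /step flat_le0 ?mul0r// subr_le0. Qed.

Lemma step1 e x : 0 < e -> e <= x -> step e x = 1.
Proof.
move=> e0 ex; have := step_den_gt0 x e0.
rewrite /step (@flat_le0 _ _ (e - x)) ?subr_le0// addr0 => h.
by rewrite divff// gt_eqF.
Qed.

Lemma step_itv e x : 0 < e -> 0 <= step e x <= 1.
Proof.
move=> e0; have d0 := step_den_gt0 x e0; apply/andP; split.
  by rewrite divr_ge0 ?flat_ge0// ltW.
by rewrite ler_pdivrMr// mul1r lerDl flat_ge0.
Qed.

(** For 0 < e <= 1/2: equal to [step e x * x] for x <= e and, symmetrically, to
    1 - step e (1 - x) * (1 - x) for x >= e; thus 0 near 0, 1 near 1, and x on
    [e, 1 - e]. *)
Definition squash e x : R := step e x * (1 - step e (1 - x) * (1 - x)).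

Lemma squash_low e x : 0 < e -> e <= 2^-1 -> x <= e -> squash e x = step e x * x.
Proof. by move=> e0 e2 xe; rewrite /squash (@step1 e (1 - x))//; [ring|lra]. Qed.

Lemma squash_high e x : 0 < e -> e <= x -> squash e x = 1 - step e (1 - x) * (1 - x).
Proof. by move=> e0 ex; rewrite /squash step1// mul1r. Qed.

Lemma squash_near e x (a : bool) : 0 < e -> e <= 2^-1 ->
  `|x - a%:R| <= e / 2 -> squash e x = a%:R.
Proof.
rewrite ler_norml => e0 e2 /andP[x1 x2]; case: a x1 x2 => /= x1 x2.
  by rewrite squash_high ?step0 ?mul0r ?subr0//; lra.
by rewrite squash_low ?step0 ?mul0r//; lra.
Qed.

Lemma squash_itv e x : 0 < e -> e <= 2^-1 -> 0 <= x <= 1 -> 0 <= squash e x <= 1.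
Proof.
move=> e0 e2 x01; have [xe|xe] := leP x e.
  by rewrite squash_low//; have := step_itv x e0; nra.
by rewrite squash_high ?(ltW xe)//; have := step_itv (1 - x) e0; nra.
Qed.

(** A point moved by [squash e] stays e-close to the same endpoint. *)
Lemma squash_close e x : 0 < e -> e <= 2^-1 -> 0 <= x <= 1 ->
  squash e x = x \/
  exists a : bool, `|x - a%:R| <= e /\ `|squash e x - a%:R| <= e.
Proof.
move=> e0 e2 x01; have [xe|xe] := leP x e.
  right; exists false; rewrite squash_low// /= !ler_norml.
  by have := step_itv x e0; split; nra.
have [ex|ex] := leP e (1 - x).
  by left; rewrite squash_high ?(ltW xe)// step1//; lra.
right; exists true; rewrite squash_high ?(ltW xe)// /= !ler_norml.
by have := step_itv (1 - x) e0; split; nra.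
Qed.

Lemma Ck_squash e (V : normedModType R) (U : set V) k (u : V -> R) :
  open U -> 0 < e -> Ck k U u -> Ck k U (fun z => squash e (u z)).
Proof.
move=> oU e0.
have Ck_step w : Ck k U w -> Ck k U (fun z => step e (w z)).
  move=> kw.
  have k1 : Ck k U (fun z => flat 0 (w z - e / 2)).
    by apply: (Ck_flat oU 0); apply: Ck_sub_fun => //; exact: Ck_cst.
  have k2 : Ck k U (fun z => flat 0 (e - w z)).
    by apply: (Ck_flat oU 0); apply: Ck_sub_fun => //; exact: Ck_cst.
  apply: Ck_mul => //; apply: Ck_inv => //; last exact: Ck_add.
  by move=> x _; rewrite gt_eqF// step_den_gt0.
move=> ku.
have k1u : Ck k U (fun z => 1 - u z) by apply: Ck_sub_fun => //; exact: Ck_cst.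
apply: Ck_mul => //; first exact: Ck_step.
apply: Ck_sub_fun => //; first exact: Ck_cst.
by apply: Ck_mul => //; exact: Ck_step.
Qed.

End squashing.

(** * Faces and tame maps on subsets of R^n *)

(** A face of I^n is given by the coordinates that are fixed on it ([Some b]) and
    those that are free ([None]). *)
Definition sig n := {ffun 'I_n -> option bool}.

Section faces.
Variable R : realType.

Definition face n (c : sig n) : set 'rV[R]_n :=
  [set x | cube R n x /\ forall i b, c i = Some b -> x 0 i = b%:R].

(** The cubical subcomplex formed by the faces in [S]. *)
Definition faces n (S : {set sig n}) : set 'rV[R]_n :=
  [set x | exists2 c, c \in S & face c x].

(** Smoothness, tameness with constant e and tameness of the restriction of [f]
    to [K]. *)
Definition smooth_on n (Y : diffeologicalType R) (K : set 'rV[R]_n)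
    (f : 'rV[R]_n -> Y) :=
  forall m (U : set 'rV[R]_m) (q : 'rV[R]_m -> 'rV[R]_n),
    plot U q -> (forall x, U x -> K (q x)) -> plot U (f \o q).

Definition eps_tame_on n (Y : Type) (K : set 'rV[R]_n) (e : R)
    (f : 'rV[R]_n -> Y) :=
  forall x j (a : bool), K x -> `|x 0 j - a%:R| <= e ->
    K (set_coord x j a%:R) -> f x = f (set_coord x j a%:R).

Definition tame_on n (Y : diffeologicalType R) (K : set 'rV[R]_n)
    (f : 'rV[R]_n -> Y) :=
  smooth_on K f /\ exists e : R, [/\ 0 < e, e <= 2^-1 & eps_tame_on K e f].

(** The restriction [F] of [f] to the subspace [K] is smooth exactly when [f] is
    smooth on [K]; [tameP] is the same for tameness. *)
Lemma smooth_onP n (Y : diffeologicalType R) (K : set 'rV[R]_n)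
    (F : K -> Y) (f : 'rV[R]_n -> Y) :
  (forall z, F z = f (val z)) -> smooth F <-> smooth_on K f.
Proof.
move=> Ff; split=> [sF m U q pq Kq|sf m U p pp].
  apply: plot_local; first exact: plot_open pq.
  move=> x Ux; exists U; split=> //.
  pose x0 : K := SigSub (mem_set (Kq x Ux)).
  pose q' y : K := insubd x0 (q y).
  have q'E y : U y -> val (q' y) = q y.
    by move=> Uy; rewrite insubdK//; exact/mem_set/Kq.
  apply: (@plot_eq _ _ _ _ (F \o q')); first by move=> y Uy; rewrite /= Ff q'E.
  apply: sF; rewrite /plot/= /sub_plot.
  by apply: plot_eq pq => y Uy; rewrite q'E.
apply: (@plot_eq _ _ _ _ (f \o (fun x => val (p x)))).
  by move=> y _ /=; rewrite Ff.
by apply: sf => // x _; exact: set_valP.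
Qed.

Lemma tameP n (Y : diffeologicalType R) (K : set 'rV[R]_n)
    (F : K -> Y) (f : 'rV[R]_n -> Y) :
  (forall z, F z = f (val z)) -> tame F <-> tame_on K f.
Proof.
move=> Ff; rewrite /tame /tame_on (smooth_onP Ff).
suff E e : eps_tame e F <-> eps_tame_on K e f.
  by split=> -[sf [e [e0 e2 /E ?]]]; split=> //; exists e.
split=> [tF x j a Kx xa Kxa|tf t s j a ta ts].
  by have := tF (SigSub (mem_set Kx)) (SigSub (mem_set Kxa)) j a xa erefl; rewrite !Ff.
by rewrite !Ff ts; apply: tf => //; rewrite -?ts; exact: set_valP.
Qed.

Lemma smooth_on_eq n (Y : diffeologicalType R) (K : set 'rV[R]_n) (f g : 'rV[R]_n -> Y) :
  (forall x, K x -> f x = g x) -> smooth_on K f -> smooth_on K g.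
Proof.
move=> fg sf m U q pq Kq; apply: plot_eq (sf m U q pq Kq) => x Ux.
by rewrite /= fg//; exact: Kq.
Qed.

Lemma tame_on_eq n (Y : diffeologicalType R) (K : set 'rV[R]_n) (f g : 'rV[R]_n -> Y) :
  (forall x, K x -> f x = g x) -> tame_on K f -> tame_on K g.
Proof.
move=> fg [sf [e [e0 e2 tf]]]; split; first exact: smooth_on_eq sf.
by exists e; split=> // x j a Kx xa Kxa; rewrite -!fg//; exact: tf.
Qed.

Lemma smooth_on_sub n (Y : diffeologicalType R) (K K' : set 'rV[R]_n)
    (f : 'rV[R]_n -> Y) :
  K' `<=` K -> smooth_on K f -> smooth_on K' f.
Proof. by move=> sK sf m U q pq Kq; apply: sf => // x /Kq/sK. Qed.

Lemma tame_on_sub n (Y : diffeologicalType R) (K K' : set 'rV[R]_n) (f : 'rV[R]_n -> Y) :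
  K' `<=` K -> tame_on K f -> tame_on K' f.
Proof.
move=> sK [sf [e [e0 e2 tf]]]; split; first exact: smooth_on_sub sf.
by exists e; split=> // x j a /sK Kx xa /sK Kxa; exact: tf.
Qed.

Lemma bool_close (a b : bool) (e : R) : e <= 2^-1 -> `|a%:R - b%:R| <= e -> a = b.
Proof.
move=> e2; rewrite ler_norml => /andP[].
by case: a; case: b => //=; lra.
Qed.

(** A coordinate fixed on a face is close to an endpoint only if it is that
    endpoint; hence resetting a coordinate close to an endpoint to that endpoint
    does not leave the face. *)
Lemma face_near n (c : sig n) (e : R) x j (a : bool) : e <= 2^-1 ->
  face c x -> `|x 0 j - a%:R| <= e -> face c (set_coord x j a%:R).
Proof.
move=> e2 [cx xc] xa; split=> [i|i b cib]; rewrite mxE; case: eqP => [ij|_].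
- by case: (a); rewrite /= lexx ler01.
- exact: cx.
- by move: xa; rewrite -ij (xc _ _ cib) => /(bool_close e2) ->.
- exact: xc.
Qed.

(** An e-tame map on a face does not distinguish points each of whose coordinates
    are equal or e-close to the same endpoint. *)
Lemma eps_tame_on_eq n (Y : Type) (c : sig n) (e : R) (f : 'rV[R]_n -> Y) x y :
  e <= 2^-1 -> eps_tame_on (face c) e f -> face c x -> face c y ->
  (forall i, x 0 i = y 0 i \/
     exists a : bool, `|x 0 i - a%:R| <= e /\ `|y 0 i - a%:R| <= e) ->
  f x = f y.
Proof.
move=> e2 tf fx fy xy.
(* The coordinates of x are replaced by those of y one at a time; the
   replacement of a coordinate close to an endpoint passes through it. *)
pose mix (l : seq 'I_n) : 'rV[R]_n := \row_i (if i \in l then y 0 i else x 0 i).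
have fmix l : face c (mix l).
  by split=> [i|i b cib]; rewrite mxE; case: ifP => _;
    [exact: fy.1|exact: fx.1|exact: fy.2|exact: fx.2].
have E l : f (mix [::]) = f (mix l).
  elim: l => // i l ->; have [il|il] := boolP (i \in l).
    congr f; apply/rowP => k; rewrite !mxE in_cons.
    by case: eqP => // ->; rewrite il.
  have mixi : mix l 0 i = x 0 i by rewrite mxE (negbTE il).
  have mixil : mix (i :: l) 0 i = y 0 i by rewrite mxE mem_head.
  case: (xy i) => [xyi|[a [xa ya]]].
    congr f; apply/rowP => k; rewrite !mxE in_cons.
    by case: eqP => // ->; rewrite (negbTE il) xyi.
  rewrite (tf _ i a (fmix l)) ?mixi//; last first.
    by apply: face_near e2 (fmix _) _; rewrite mixi.
  rewrite (tf _ i a (fmix (i :: l))) ?mixil//; last first.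
    by apply: face_near e2 (fmix _) _; rewrite mixil.
  by congr f; apply/rowP => k; rewrite !mxE in_cons; case: eqP.
rewrite (_ : x = mix [::]); last by apply/rowP => i; rewrite mxE.
rewrite (E (enum 'I_n)); congr f; apply/rowP => i.
by rewrite mxE mem_enum.
Qed.

Lemma uniform_positive (T : finType) (S : {set T}) (P : T -> R -> Prop) :
  (forall c e e', 0 < e' -> e' <= e -> P c e -> P c e') ->
  (forall c, c \in S -> exists e, [/\ 0 < e, e <= 2^-1 & P c e]) ->
  exists e, [/\ 0 < e, e <= 2^-1 & forall c, c \in S -> P c e].
Proof.
move=> mP HP.
suff [e [e0 e2 He]] : exists e, [/\ 0 < e, e <= 2^-1 & forall c, c \in enum S -> P c e].
  by exists e; split=> // c cS; apply: He; rewrite mem_enum.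
have : {subset enum S <= S} by move=> c; rewrite mem_enum.
elim: (enum S) => [|c l IH] sub; first by exists 2^-1.
have [|e [e0 e2 He]] := IH; first by move=> d dl; apply: sub; rewrite in_cons dl orbT.
have [e' [e'0 e'2 He']] := HP c (sub _ (mem_head _ _)).
exists (Num.min e e'); split; first by rewrite lt_min e0.
  by rewrite ge_min e2.
move=> d; rewrite in_cons => /predU1P[->|/He Hd].
  by apply: mP He'; rewrite ?lt_min ?e0// ge_min lexx orbT.
by apply: mP Hd; rewrite ?lt_min ?e0// ge_min lexx.
Qed.

Lemma eps_tame_onW n (Y : Type) (K : set 'rV[R]_n) (e e' : R) (f : 'rV[R]_n -> Y) :
  e' <= e -> eps_tame_on K e f -> eps_tame_on K e' f.
Proof. by move=> ee tf x j a Kx xa; apply: tf => //; exact: le_trans ee. Qed.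

Lemma uniform_eps_tame n (Y : diffeologicalType R) (S : {set sig n}) (f : 'rV[R]_n -> Y) :
  (forall c, c \in S -> tame_on (face c) f) ->
  exists e, [/\ 0 < e, e <= 2^-1 & forall c, c \in S -> eps_tame_on (face c) e f].
Proof.
move=> tf; apply: uniform_positive => [c e e' _|c /tf[]//]; exact: eps_tame_onW.
Qed.

(** The map R^m -> R^n each of whose components is a coordinate ([inl]) or an
    endpoint 0 or 1 ([inr]): inclusions of faces and coordinate projections. *)
Definition cubmap n m (s : 'I_n -> 'I_m + bool) (y : 'rV[R]_m) : 'rV[R]_n :=
  \row_i match s i with inl k => y 0 k | inr b => b%:R end.

(** No coordinate is used twice; this is what makes composition with [cubmap s]
    preserve tameness. *)
Definition coord_inj n m (s : 'I_n -> 'I_m + bool) :=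
  forall i i' k, s i = inl k -> s i' = inl k -> i = i'.

Lemma plot_rV m (U : set 'rV[R]_m) n (q : 'rV[R]_m -> 'rV[R]_n) : open U ->
  plot U q <-> forall i, plot U (fun x => q x 0 i).
Proof.
move=> oU; split=> [[_ sq] i|sq].
  by split=> // k; apply: Ck_coord (sq k).
by split=> // k; apply/Ck_coordP => // i; case: (sq i) => _ /(_ k).
Qed.

Lemma plot_cubmap n m l (s : 'I_n -> 'I_m + bool) (U : set 'rV[R]_l) q :
  plot U q -> plot U (cubmap s \o q).
Proof.
move=> pq; have oU := plot_open pq; apply/plot_rV => // i.
case E : (s i) => [k|b].
  by apply: plot_eq ((plot_rV q oU).1 pq k) => x _ /=; rewrite mxE E.
by apply: plot_eq (plot_cst (b%:R : R) oU) => x _ /=; rewrite mxE E.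
Qed.

Lemma cube_cubmap n m (s : 'I_n -> 'I_m + bool) y : cube R m y -> cube R n (cubmap s y).
Proof.
by move=> cy i; rewrite mxE; case: (s i) => [k|[]]; rewrite ?lexx ?ler01 ?cy.
Qed.

Lemma smooth_on_cubmap n m (Y : diffeologicalType R) (s : 'I_n -> 'I_m + bool)
    (K : set 'rV[R]_n) (K' : set 'rV[R]_m) (f : 'rV[R]_n -> Y) :
  (forall y, K' y -> K (cubmap s y)) ->
  smooth_on K f -> smooth_on K' (f \o cubmap s).
Proof.
move=> sK sf l U q pq Kq; apply: (sf _ _ (cubmap s \o q)).
  exact: plot_cubmap.
by move=> x /Kq/sK.
Qed.

Lemma tame_on_cubmap n m (Y : diffeologicalType R) (s : 'I_n -> 'I_m + bool)
    (K : set 'rV[R]_n) (K' : set 'rV[R]_m) (f : 'rV[R]_n -> Y) :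
  coord_inj s -> (forall y, K' y -> K (cubmap s y)) ->
  tame_on K f -> tame_on K' (f \o cubmap s).
Proof.
move=> sI sK [sf [e [e0 e2 tf]]]; split; first exact: smooth_on_cubmap sf.
exists e; split=> // y k a Ky ya Kya /=.
have [[i si]|nk] := pselect (exists i, s i = inl k); last first.
  congr f; apply/rowP => i; rewrite !mxE; case E : (s i) => [k'|//].
  by rewrite mxE; case: eqP => // k'k; case: nk; exists i; rewrite E k'k.
have E : cubmap s (set_coord y k a%:R) = set_coord (cubmap s y) i a%:R.
  apply/rowP => i'; rewrite !mxE; case: eqP => [->|ii'].
    by rewrite si mxE eqxx.
  case E : (s i') => [k'|//]; rewrite mxE; case: eqP => // k'k.
  by case: ii'; apply: sI si; rewrite E k'k.
rewrite E; apply: tf; [exact: sK|by rewrite mxE si|by rewrite -E; exact: sK].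
Qed.

(** The smallest face containing a point of the cube. *)
Definition sig_of n (x : 'rV[R]_n) : sig n :=
  [ffun i => if x 0 i == 0 then Some false else if x 0 i == 1 then Some true else None].

Lemma face_sig_of n (x : 'rV[R]_n) : cube R n x -> face (sig_of x) x.
Proof.
move=> cx; split=> // i b; rewrite ffunE.
by case: eqP => [-> [<-]//|_]; case: eqP => [-> [<-]|].
Qed.

(** [subsig c d]: the face [c] is contained in the face [d]. *)
Definition subsig n (c d : sig n) := [forall i, (d i != None) ==> (c i == d i)].

Lemma subsigP n (c d : sig n) :
  reflect (forall i b, d i = Some b -> c i = Some b) (subsig c d).
Proof.
apply: (iffP forallP) => [H i b db|H i].
  by move: (H i); rewrite db /= => /eqP.
by case E : (d i) => [b|]//=; apply/eqP/H.
Qed.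

Lemma face_sub n (c d : sig n) : subsig c d -> face c `<=` face d.
Proof. by move=> /subsigP cd x [cx xc]; split=> // i b /cd/xc. Qed.

Lemma sig_of_sub n (c : sig n) x : face c x -> subsig (sig_of x) c.
Proof.
move=> [_ xc]; apply/subsigP => i b /xc; rewrite ffunE => ->.
by case: b; rewrite /= ?eqxx ?oner_eq0.
Qed.

(** Tame maps on faces glue to a tame map on their union. *)
Lemma tame_on_faces n (Y : diffeologicalType R) (S : {set sig n}) (f : 'rV[R]_n -> Y) :
  (forall c, c \in S -> tame_on (face c) f) -> tame_on (faces S) f.
Proof.
move=> tf; have [e [e0 e2 te]] := uniform_eps_tame tf; split; last first.
  exists e; split=> // x j a [c cS cx] xa _.
  by apply: te (cx) (xa) _ => //; exact: face_near xa.
move=> m U q pq Kq; have oU := plot_open pq; apply: plot_local => // x Ux.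
(* [cubmap s] projects onto the smallest face containing q x; on the
   neighbourhood [V] of x, [f] is unchanged by this projection. *)
pose s : 'I_n -> 'I_n + bool :=
  fun i => if sig_of (q x) i is Some b then inr b else inl i.
pose V := U `&` [set y | forall i, `|q y 0 i - q x 0 i| < e].
have oV : open V.
  rewrite openE => y [Uy Vy]; apply: filterI; first exact: open_nbhs_nbhs.
  apply: (@filter_forall _ _ (fun i => [set y | `|q y 0 i - q x 0 i| < e])
    (nbhs y) _) => i.
  have cq : {for y, continuous (fun y => q y 0 i)}.
    have [_ /(_ 0%N) /Ck_continuous] := (plot_rV q oU).1 pq i; exact.
  have cq' : {for y, continuous (fun y => `|q y 0 i - q x 0 i|)}.
    apply: (@continuous_comp _ _ _ _ (@Num.norm _ R)); last exact: norm_continuous.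
    by apply: continuousB => //; exact: cst_continuous.
  by apply: (cq' [set z | z < e]); apply: lt_nbhsl; exact: Vy.
exists V; split; [by split=> // i; rewrite subrr normr0|by move=> y []|].
have [c cS cx] := Kq x Ux.
have cube_q y : U y -> cube R n (q y) by move=> /Kq[? _ []].
have fs y : U y -> face (sig_of (q x)) (cubmap s (q y)).
  move=> Uy; split; first by apply: cube_cubmap; exact: cube_q.
  by move=> i b E; rewrite mxE /s E.
have pVq : plot V q by apply: (plot_comp pq oV (fun k => Ck_id k V)) => y [].
apply: (@plot_eq _ _ _ _ (f \o (cubmap s \o q))) => [y [Uy Vy] /=|].
  have [d dS dy] := Kq y Uy.
  have near_b i b : sig_of (q x) i = Some b -> `|q y 0 i - b%:R| <= e.
    by move=> E; rewrite -(((face_sig_of (cube_q x Ux)).2) _ _ E) ltW.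
  apply/esym/(eps_tame_on_eq e2 (te d dS)) => //.
    split=> [|i b dib]; first by apply: cube_cubmap; exact: cube_q.
    rewrite mxE /s; case E : (sig_of (q x) i) => [b'|]; last exact: dy.2.
    by have := near_b _ _ E; rewrite (dy.2 _ _ dib) => /(bool_close e2) ->.
  move=> i; rewrite mxE /s; case E : (sig_of (q x) i) => [b|]; last by left.
  by right; exists b; rewrite near_b// subrr normr0 ltW.
have /(smooth_on_sub (face_sub (sig_of_sub cx))) sf := (tf c cS).1.
by apply: sf => [|y [Uy _]]; [exact: plot_cubmap|exact: fs].
Qed.

End faces.

(** * Cylinders, parametrized faces and fillers *)

(** The first coordinates of a point of R^(n+1); the last one is
    [y 0 ord_max]. *)
Definition ini (R : realType) n (y : 'rV[R]_n.+1) : 'rV[R]_n :=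
  \row_i y 0 (lift ord_max i).

Definition snoc (R : realType) n (x : 'rV[R]_n) (t : R) : 'rV[R]_n.+1 :=
  \row_i if unlift ord_max i is Some j then x 0 j else t.

(** The cylinder over a face. *)
Definition sext n (c : sig n) : sig n.+1 :=
  [ffun i => if unlift ord_max i is Some j then c j else None].

(** [cubmap (cext s)] is the product of [cubmap s] with the identity of the last
    coordinate. *)
Definition cext n m (s : 'I_n -> 'I_m + bool) (i : 'I_n.+1) : 'I_m.+1 + bool :=
  if unlift ord_max i is Some j then
    match s j with inl k => inl (lift ord_max k) | inr b => inr b end
  else inl ord_max.

Section cylinder.
Variable R : realType.

Lemma cube_face n : cube R n = face [ffun=> None].
Proof.
apply/seteqP; split=> [x cx|x []//]; split=> // i b; by rewrite ffunE.
Qed.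

Lemma cube0 n : cube R n 0.
Proof. by move=> i; rewrite mxE lexx ler01. Qed.

(** A smooth map [G] on the cube that agrees with [f] on the faces [S] and lifts
    [g] can be made tame when [f] and [g] are tame. *)
Lemma retame_filler n (Y Z : diffeologicalType R) (S : {set sig n}) (p : Y -> Z)
    (G f : 'rV[R]_n -> Y) (g : 'rV[R]_n -> Z) :
  smooth_on (cube R n) G -> (forall c, c \in S -> tame_on (face c) f) ->
  tame_on (cube R n) g -> (forall x, faces S x -> G x = f x) ->
  (forall x, cube R n x -> p (G x) = g x) ->
  exists G', [/\ tame_on (cube R n) G', (forall x, faces S x -> G' x = f x) &
    (forall x, cube R n x -> p (G' x) = g x)].
Proof.
move=> sG tf [sg [e1 [e10 e12 tg]]] Gf pG.
have [e2 [e20 e22 te]] := uniform_eps_tame tf.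
pose e := Num.min e1 e2.
have e0 : 0 < e by rewrite lt_min e10.
have eh : e <= 2^-1 by rewrite ge_min e12.
have {}te c : c \in S -> eps_tame_on (face c) e f.
  by move=> /te; apply: eps_tame_onW; rewrite ge_min lexx orbT.
have {}tg : eps_tame_on (face [ffun=> None]) e g.
  by rewrite -cube_face; apply: eps_tame_onW tg; rewrite ge_min lexx.
pose Psi (x : 'rV[R]_n) : 'rV[R]_n := \row_i squash e (x 0 i).
have cPsi x : cube R n x -> cube R n (Psi x).
  by move=> cx i; rewrite mxE squash_itv//; exact: cx.
have fPsi c x : face c x -> face c (Psi x).
  move=> [cx xc]; split=> [|i b /xc E]; first exact: cPsi.
  by rewrite mxE E (@squash_near _ _ _ b)// subrr normr0 divr_ge0// ltW.
have close x i : cube R n x -> Psi x 0 i = x 0 i \/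
   exists a : bool, `|Psi x 0 i - a%:R| <= e /\ `|x 0 i - a%:R| <= e.
  move=> cx; rewrite mxE; have [->|[a [? ?]]] := squash_close e0 eh (cx i).
    by left.
  by right; exists a.
exists (G \o Psi); split=> [|x [c cS cx] /=|x cx /=].
- split=> [m U q pq Kq|].
    apply: (sG _ _ (Psi \o q)) => [|x Ux]; last exact/cPsi/Kq.
    have oU := plot_open pq.
    apply/plot_rV => // i; have [_ sq] := (plot_rV q oU).1 pq i.
    split=> // k; apply: (@Ck_eq _ _ _ _ _ (fun z => squash e (q z 0 i))) => //.
      by move=> z _; rewrite mxE.
    exact: Ck_squash.
  exists (e / 2); split; [by rewrite divr_gt0|lra|].
  move=> x j a _ xa _ /=; congr G; apply/rowP => i; rewrite !mxE.
  case: eqP => // ->; rewrite (@squash_near _ _ (x 0 j) a)// (@squash_near _ _ _ a)//.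
  by rewrite subrr normr0 divr_ge0// ltW.
- have fc : face c (Psi x) by exact: fPsi.
  rewrite Gf; last by exists c.
  apply: (eps_tame_on_eq eh (te _ cS)) => // i; apply: close; exact: cx.1.
- rewrite pG; last exact: cPsi.
  apply: (eps_tame_on_eq eh tg); rewrite -?cube_face//; first exact: cPsi.
  by move=> i; exact: close.
Qed.

Lemma ini_snoc n (x : 'rV[R]_n) t : ini (snoc x t) = x.
Proof. by apply/rowP => i; rewrite !mxE liftK. Qed.

Lemma last_snoc n (x : 'rV[R]_n) t : snoc x t 0 ord_max = t.
Proof. by rewrite mxE unlift_none. Qed.

Lemma row_lastP n (y z : 'rV[R]_n.+1) :
  ini y = ini z -> y 0 ord_max = z 0 ord_max -> y = z.
Proof.
move=> yz yz0; apply/rowP => i; case: (unliftP ord_max i) => [j ->|->//].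
by move/rowP: yz => /(_ j); rewrite !mxE.
Qed.

Lemma snoc_ini n (y : 'rV[R]_n.+1) : snoc (ini y) (y 0 ord_max) = y.
Proof. by apply: row_lastP; rewrite ?ini_snoc ?last_snoc. Qed.

Lemma ini_cext n m (s : 'I_n -> 'I_m + bool) (y : 'rV[R]_m.+1) :
  ini (cubmap (cext s) y) = cubmap s (ini y).
Proof.
apply/rowP => i; rewrite !mxE /cext liftK.
by case: (s i) => [k|//]; rewrite mxE.
Qed.

Lemma last_cext n m (s : 'I_n -> 'I_m + bool) (y : 'rV[R]_m.+1) :
  cubmap (cext s) y 0 ord_max = y 0 ord_max.
Proof. by rewrite mxE /cext unlift_none. Qed.

Lemma coord_inj_cext n m (s : 'I_n -> 'I_m + bool) : coord_inj s -> coord_inj (cext s).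
Proof.
move=> sI i i' k; rewrite /cext.
case: (unliftP ord_max i) => [j ->|->]; case: (unliftP ord_max i') => [j' ->|->] //.
- case E : (s j) => [l|//] [<-]; case E' : (s j') => [l'|//] [].
  move=> bb; have ll : l' = l by apply/val_inj/(can_inj (bumpK m)).
  by congr lift; apply: sI E _; rewrite E' ll.
- case: (s j) => [l|//] [<-] [] /eqP; by rewrite (negbTE (neq_bump _ _)).
- case: (s j') => [l|//] [<-] [] /eqP; by rewrite eq_sym (negbTE (neq_bump _ _)).
Qed.

Lemma cubeS n (y : 'rV[R]_n.+1) :
  cube R n.+1 y <-> cube R n (ini y) /\ 0 <= y 0 ord_max <= 1.
Proof.
split=> [cy|[cy y1] i]; first by split=> [i|]; rewrite ?mxE; exact: cy.
case: (unliftP ord_max i) => [j ->|->//].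
by have := cy j; rewrite mxE.
Qed.

Lemma face_sext n (c : sig n) (y : 'rV[R]_n.+1) :
  face (sext c) y <-> face c (ini y) /\ 0 <= y 0 ord_max <= 1.
Proof.
split=> [[/cubeS[cy y1] yc]|[[cy yc] y1]].
  by split=> //; split=> // i b cib; rewrite mxE; apply: yc; rewrite ffunE liftK.
split=> [|i b]; first exact/cubeS.
rewrite ffunE; case: unliftP => [j ->|//] /yc; by rewrite mxE.
Qed.

(** [s] lists the free coordinates of the face [c], and [b] gives the values of the
    other ones; then [face_map s b] parametrizes the face. *)
Definition params n (c : sig n) d (s : 'I_d -> 'I_n) (b : 'I_n -> bool) :=
  [/\ injective s, forall k, c (s k) = None &
      forall i, (exists k, s k = i) \/ c i = Some (b i)].

(** The parametrization [face_map s b], as a [cubmap] (see [face_mapE]). *)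
Definition fsig n d (s : 'I_d -> 'I_n) (b : 'I_n -> bool) (i : 'I_n) : 'I_d + bool :=
  if [pick k | s k == i] is Some k then inl k else inr (b i).

(** The projection onto the coordinates listed by [s], a left inverse of
    [face_map s b] for injective [s]. *)
Definition proj n d (s : 'I_d -> 'I_n) (k : 'I_d) : 'I_n + bool := inl (s k).

Lemma face_mapE n d (s : 'I_d -> 'I_n) b (y : 'rV[R]_d) :
  face_map s b y = cubmap (fsig s b) y.
Proof. by apply/rowP => i; rewrite !mxE /fsig; case: pickP. Qed.

Lemma coord_inj_fsig n d (s : 'I_d -> 'I_n) b : coord_inj (fsig s b).
Proof.
move=> i i' k; rewrite /fsig; case: pickP => [l /eqP <-|//] [<-].
by case: pickP => [l' /eqP <-|//] [->].
Qed.

Lemma coord_inj_proj n d (s : 'I_d -> 'I_n) : injective s -> coord_inj (proj s).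
Proof. by move=> sI i i' k [<-] [/sI ->]. Qed.

Section params.
Variables (n : nat) (c : sig n) (d : nat) (s : 'I_d -> 'I_n) (b : 'I_n -> bool).
Hypothesis csb : params c s b.

Lemma fsigK k : fsig s b (s k) = inl k.
Proof.
have [sI _ _] := csb.
by rewrite /fsig; case: pickP => [l /eqP/sI->//|/(_ k)]; rewrite eqxx.
Qed.

Lemma fsig_fixed i a : c i = Some a -> fsig s b i = inr a.
Proof.
have [_ sN cs] := csb; rewrite /fsig; case: pickP => [l /eqP <-|ns].
  by rewrite sN.
by case: (cs i) => [[k /eqP]|-> [->//]]; rewrite ns.
Qed.

Lemma face_fsig (y : 'rV[R]_d) : cube R d y -> face c (cubmap (fsig s b) y).
Proof.
move=> cy; split=> [|i a ci]; first exact: cube_cubmap.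
by rewrite mxE (fsig_fixed ci).
Qed.

Lemma fsigK_proj (x : 'rV[R]_n) : face c x ->
  cubmap (fsig s b) (cubmap (proj s) x) = x.
Proof.
move=> [_ xc]; have [_ _ cs] := csb; apply/rowP => i; rewrite mxE.
case: (cs i) => [[k <-]|ci]; first by rewrite fsigK mxE.
by rewrite (fsig_fixed ci) (xc _ _ ci).
Qed.

Lemma face_fsig_ext (y : 'rV[R]_d.+1) :
  cube R d.+1 y -> face (sext c) (cubmap (cext (fsig s b)) y).
Proof.
move=> /cubeS[cy y1]; apply/face_sext; rewrite ini_cext last_cext; split=> //.
exact: face_fsig.
Qed.

Lemma fsigK_proj_ext (x : 'rV[R]_n.+1) : face (sext c) x ->
  cubmap (cext (fsig s b)) (cubmap (cext (proj s)) x) = x.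
Proof.
move=> /face_sext[fx _]; apply: row_lastP; rewrite ?last_cext//.
by rewrite !ini_cext fsigK_proj.
Qed.

(** Tameness on a face, or on the cylinder over it, is tameness of the composite
    with the parametrization. *)
Lemma tame_on_params (Y : diffeologicalType R) (f : 'rV[R]_n -> Y) :
  tame_on (face c) f <-> tame_on (cube R d) (f \o cubmap (fsig s b)).
Proof.
have [sI _ _] := csb; split=> tf.
  by apply: tame_on_cubmap tf; [exact: coord_inj_fsig|exact: face_fsig].
apply: tame_on_eq (tame_on_cubmap (coord_inj_proj sI) _ tf) => [x fx /=|x [cx _]].
  by rewrite fsigK_proj.
exact: cube_cubmap.
Qed.

Lemma tame_on_params_ext (Y : diffeologicalType R) (f : 'rV[R]_n.+1 -> Y) :
  tame_on (face (sext c)) f <->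
  tame_on (cube R d.+1) (f \o cubmap (cext (fsig s b))).
Proof.
have [sI _ _] := csb; split=> tf.
  apply: tame_on_cubmap tf; first exact/coord_inj_cext/coord_inj_fsig.
  exact: face_fsig_ext.
have I := coord_inj_cext (coord_inj_proj sI).
apply: tame_on_eq (tame_on_cubmap I _ tf) => [x fx /=|x [cx _]].
  by rewrite fsigK_proj_ext.
exact: cube_cubmap.
Qed.

End params.

(** The faces of I^(d+1) contained in the open box. *)
Definition box_sigs d : {set sig d.+1} :=
  [set c : sig d.+1 | [exists i : 'I_d, c (lift ord_max i) != None]
    || (c ord_max == Some false)].

Lemma open_box_faces d : open_box R d = faces (box_sigs d).
Proof.
apply/seteqP; split=> [x [cx bx]|x [c + [cx xc]]].
  exists (sig_of x); last exact: face_sig_of.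
  rewrite inE; case: bx => [[i [a xa]]|x0]; apply/orP; [left|right].
    apply/existsP; exists i; rewrite ffunE xa; case: (a) => /=.
      by rewrite oner_eq0 eqxx.
    by rewrite eqxx.
  by rewrite ffunE x0 eqxx.
rewrite inE => /orP bc; split=> //; case: bc => [/existsP[i]|/eqP ci].
  by case E : (c _) => [a|//] _; left; exists i, a; exact: xc.
by right; rewrite (xc _ _ ci).
Qed.

End cylinder.

(** * Extension over one cube and over a model *)

(** Closure under passing to a subface. *)
Definition down_closed n (D : {set sig n}) :=
  forall c d : sig n, subsig c d -> d \in D -> c \in D.

(** The subface of [c] on which coordinate [i] is [a]. *)
Definition set_sig n (c : sig n) (i : 'I_n) (a : bool) : sig n :=
  [ffun j => if j == i then Some a else c j].

(** The dimension of a face. *)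
Definition free_dim n (c : sig n) := #|[pred i | c i == None]|.

Lemma set_sig_sub n (c : sig n) i a : c i = None -> subsig (set_sig c i a) c.
Proof.
move=> ci; apply/subsigP => j b cj; rewrite ffunE; case: eqP => // ji.
by move: cj; rewrite ji ci.
Qed.

Lemma free_set_sig n (c : sig n) i a : c i = None ->
  (free_dim (set_sig c i a) < free_dim c)%N.
Proof.
move=> ci; apply: proper_card; apply/properP; split.
  by apply/fintype.subsetP => j; rewrite !inE ffunE; case: ifP.
by exists i; [rewrite inE ci|rewrite inE ffunE eqxx].
Qed.

Lemma homo_ord_inj d n (s : 'I_d -> 'I_n) :
  {homo s : j k / (j < k)%N} -> injective s.
Proof.
move=> hs j k jk; apply/val_inj; case: (ltngtP j k) => // /hs;
by rewrite jk ltnn.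
Qed.

Lemma params_of_sig n (c : sig n) :
  exists d (s : 'I_d -> 'I_n) b, {homo s : j k / (j < k)%N} /\ params c s b.
Proof.
pose l := [seq i <- enum 'I_n | c i == None].
have ul : uniq l by rewrite filter_uniq// enum_uniq.
have sl : sorted ltn (map val l).
  apply: (subseq_sorted ltn_trans (s2 := map val (enum 'I_n))).
    exact/map_subseq/filter_subseq.
  by rewrite val_enum_ord iota_ltn_sorted.
have lP i : (i \in l) = (c i == None) by rewrite mem_filter mem_enum andbT.
exists (size l), (tnth (in_tuple l)), (fun i => odflt false (c i)).
have lt_s : {homo tnth (in_tuple l) : j k / (j < k)%N}.
  move=> j k jk; have x0 := tnth (in_tuple l) j.
  rewrite !(tnth_nth x0) /= -!(nth_map x0 0%N val)//.
  by apply: (sorted_ltn_nth ltn_trans) => //; rewrite inE size_map.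
split=> //; split.
- exact: homo_ord_inj.
- by move=> k; apply/eqP; rewrite -lP; exact: mem_tnth.
- move=> i; case E : (c i) => [b|]; [by right|left].
  have /tnthP[k ->] : i \in in_tuple l by rewrite lP E.
  by exists k.
Qed.

Section extension.
Variables (R : realType) (E B : diffeologicalType R) (p : E -> B).
Hypothesis wp : weak_fibration p.

(** A face outside a closed set of faces meets their union only in its boundary. *)
Lemma face_boundary n (D : {set sig n}) (c : sig n) (x : 'rV[R]_n) :
  down_closed D -> c \notin D -> face c x -> faces D x ->
  exists i (a : bool), c i = None /\ x 0 i = a%:R.
Proof.
move=> dD cD [cx xc] [d dD' [_ xd]]; apply: contrapT => nb.
move: cD; apply/negP; rewrite negbK; apply: dD dD'; apply/subsigP => i b db.
case ci : (c i) => [b'|]; last by case: nb; exists i, b; split=> //; exact: xd.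
congr Some; apply: (@bool_close R _ _ 2^-1) => //.
by rewrite -(xc _ _ ci) (xd _ _ db) subrr normr0 invr_ge0.
Qed.

(** If the lift [H] of [k] is given over the faces in [D], among which is the whole
    boundary of [c], then there is a tame lift over [c] that agrees with [H] and
    starts at [f]. *)
Lemma fill_cylinder n (D : {set sig n}) (c : sig n) (H : 'rV[R]_n.+1 -> E)
    (f : 'rV[R]_n -> E) (k : 'rV[R]_n.+1 -> B) :
  down_closed D -> c \notin D ->
  (forall i a, c i = None -> set_sig c i a \in D) ->
  (forall d, d \in D -> tame_on (face (sext d)) H) ->
  (forall y, faces D (ini y) -> y 0 ord_max = 0 -> H y = f (ini y)) ->
  (forall y, faces D (ini y) -> 0 <= y 0 ord_max <= 1 -> p (H y) = k y) ->
  tame_on (face c) f -> tame_on (face (sext c)) k ->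
  (forall y, face c (ini y) -> y 0 ord_max = 0 -> k y = p (f (ini y))) ->
  exists G : 'rV[R]_n.+1 -> E,
    [/\ tame_on (face (sext c)) G,
        forall y, face (sext c) y -> faces D (ini y) -> G y = H y,
        forall y, face (sext c) y -> y 0 ord_max = 0 -> G y = f (ini y) &
        forall y, face (sext c) y -> p (G y) = k y].
Proof.
move=> dD cD cbD tH H0 pH tf tk k0.
have [d [s [b [hs csb]]]] := params_of_sig c; have [sI sN cs] := csb.
pose Phi : 'rV[R]_d.+1 -> 'rV[R]_n.+1 := cubmap (cext (fsig s b)).
pose Pi : 'rV[R]_n.+1 -> 'rV[R]_d.+1 := cubmap (cext (proj s)).
(* The map on the open box: [H] over the boundary of the face, and [f] on the
   bottom. *)
pose fb u := if `[< faces D (ini (Phi u)) >] then H (Phi u) else f (ini (Phi u)).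
have tfb : tame_on (open_box R d) fb.
  rewrite open_box_faces; apply: tame_on_faces => q.
  rewrite inE => /orP[/existsP[i]|/eqP q0].
    case qi : (q _) => [a|//] _.
    have Dc := cbD (s i) a (sN i).
    have I := coord_inj_cext (@coord_inj_fsig _ _ s b).
    have fq y : face q y -> face (sext (set_sig c (s i) a)) (Phi y).
      move=> [cy yq]; have [fc y1] := (face_sext _ _).1 (face_fsig_ext csb cy).
      apply/face_sext; split=> //; split; first exact: fc.1.
      move=> j e; rewrite ffunE; case: eqP => [-> [<-]|_ /fc.2//].
      by rewrite ini_cext mxE (fsigK csb) mxE (yq _ _ qi).
    apply: tame_on_eq (tame_on_cubmap I fq (tH _ Dc)) => y fy /=.
    rewrite /fb asboolT//; exists (set_sig c (s i) a) => //.
    by have /face_sext[] := fq y fy.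
  (* On the bottom face of the box, the two cases in [fb] agree. *)
  pose si (i : 'I_d) : 'I_d.+1 + bool := inl (lift ord_max i).
  have siE (y : 'rV[R]_d.+1) : cubmap si y = ini y by apply/rowP => i; rewrite !mxE.
  have sII : coord_inj si by move=> i i' j [<-] [] /(can_inj (bumpK d)) ii; apply/val_inj.
  have qs y : face q y -> cube R d (cubmap si y).
    by rewrite siE => -[/cubeS[]].
  have tb := tame_on_cubmap sII qs ((tame_on_params csb f).1 tf).
  apply: tame_on_eq tb => y [cy yq] /=; rewrite siE -ini_cext -/(Phi y) /fb.
  case: asboolP => // Dy; rewrite H0//.
  by rewrite last_cext (yq _ _ q0).
have tg := (tame_on_params_ext csb k).1 tk.
pose F (u : open_box R d) := fb (val u).
pose g (u : cube R d.+1) := k (Phi (val u)).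
have tF : tame F by apply/(tameP (f := fb)).
have tg' : tame g by apply/(tameP (f := k \o Phi)).
have pfb u : open_box R d u -> p (fb u) = k (Phi u).
  move=> bu; have cu := open_box_cube bu.
  have /face_sext[fu u1] := face_fsig_ext csb cu.
  rewrite /fb; case: asboolP => Du; first by rewrite pH.
  have [_ [[i [a ua]]|u0]] := bu; last by rewrite k0// last_cext.
  case: Du; exists (set_sig c (s i) a); first exact: cbD.
  split; first exact: fu.1.
  move=> j e; rewrite ffunE; case: eqP => [-> [<-]|_ /fu.2//].
  by rewrite ini_cext mxE (fsigK csb) mxE ua.
have pF : p \o F = g \o Defs.incl (@open_box_cube R d).
  by apply/funext => u; rewrite /= pfb//; exact: set_valP.
have [G0 [sG0 G0F pG0]] := wp.2 d F g tF tg' pF.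
pose z0 : cube R d.+1 := SigSub (mem_set (@cube0 R d.+1)).
(* Outside the cube the value of [G1] is irrelevant; points there are sent
   to 0. *)
pose G1 y := G0 (insubd z0 y).
have valG y (cy : cube R d.+1 y) : insubd z0 y = SigSub (mem_set cy) :> cube R d.+1.
  by apply/val_inj; rewrite /= insubdK//; exact/mem_set.
have sG1 : smooth_on (cube R d.+1) G1.
  by apply/(smooth_onP (F := G0)) => // z; rewrite /G1 valKd.
have G1f x : faces (box_sigs d) x -> G1 x = fb x.
  rewrite -open_box_faces => bx; rewrite /G1 (valG _ (open_box_cube bx)).
  have /(congr1 (fun h => h (SigSub (mem_set bx)))) /= := G0F.
  rewrite /F /= => <-; congr G0; exact/val_inj.
have pG1 x : cube R d.+1 x -> p (G1 x) = k (Phi x).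
  move=> cx; rewrite /G1 (valG _ cx).
  by have /(congr1 (fun h => h (SigSub (mem_set cx)))) /= := pG0.
have tfb' q : q \in box_sigs d -> tame_on (face q) fb.
  move=> qb; apply: tame_on_sub tfb => x qx; rewrite open_box_faces; by exists q.
have [G2 [tG2 G2f pG2]] := retame_filler sG1 tfb' tg G1f pG1.
have PhiPi y : face (sext c) y -> Phi (Pi y) = y by exact: fsigK_proj_ext.
have cPi y : face (sext c) y -> cube R d.+1 (Pi y).
  by move=> [cy _]; exact: cube_cubmap.
exists (G2 \o Pi); split=> [|y fy Dy|y fy y0|y fy] /=.
- apply/(tame_on_params_ext csb).
  apply: tame_on_eq tG2 => u cu /=; congr G2.
  apply: row_lastP; rewrite ?last_cext// !ini_cext.
  by apply/rowP => i; rewrite [RHS]mxE /proj [RHS]mxE (fsigK csb).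
- have [fy' y1] := (face_sext _ _).1 fy.
  have [i [a [ci ya]]] := face_boundary dD cD fy' Dy.
  have [l li] : exists l, s l = i by case: (cs i) => //; rewrite ci.
  rewrite G2f; last first.
    rewrite -open_box_faces; split; first exact: cPi.
    left; exists l, a; move: ya; rewrite mxE => <-.
    by rewrite mxE /cext liftK /proj li.
  by rewrite /fb PhiPi// asboolT.
- rewrite G2f; last first.
    rewrite -open_box_faces; split; first exact: cPi.
    by right; rewrite last_cext.
  rewrite /fb PhiPi//; case: asboolP => // Dy; exact: H0.
- by rewrite pG2; [congr k; exact: PhiPi|exact: cPi].
Qed.

(** [H] is a solution over the faces in [S]: it is tame on each cylinder, starts at
    [f] and lifts [k]. *)
Definition lift_on n (S : {set sig n}) (f : 'rV[R]_n -> E)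
    (k : 'rV[R]_n.+1 -> B) (H : 'rV[R]_n.+1 -> E) :=
  [/\ forall c, c \in S -> tame_on (face (sext c)) H,
      forall y, faces S (ini y) -> y 0 ord_max = 0 -> H y = f (ini y) &
      forall y, faces S (ini y) -> 0 <= y 0 ord_max <= 1 -> p (H y) = k y].

Lemma extend_cell n (D : {set sig n}) (c : sig n) (H : 'rV[R]_n.+1 -> E)
    (f : 'rV[R]_n -> E) (k : 'rV[R]_n.+1 -> B) :
  down_closed D -> c \notin D ->
  (forall i a, c i = None -> set_sig c i a \in D) ->
  (forall d, d \in c |: D -> tame_on (face d) f) ->
  (forall d, d \in c |: D -> tame_on (face (sext d)) k) ->
  (forall y, faces (c |: D) (ini y) -> y 0 ord_max = 0 -> k y = p (f (ini y))) ->
  lift_on D f k H ->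
  exists2 H', lift_on (c |: D) f k H' &
    forall y, faces D (ini y) -> H' y = H y.
Proof.
move=> dD cD cbD tf tk k0 [tH H0 pH].
have cc : c \in c |: D by rewrite finset.setU11.
have [|G [tG GH G0 pG]] := fill_cylinder dD cD cbD tH H0 pH (tf c cc) (tk c cc).
  by move=> y fy; apply: k0; exists c.
pose H' y := if `[< faces D (ini y) >] then H y else G y.
have H'H y : faces D (ini y) -> H' y = H y by move=> ?; rewrite /H' asboolT.
have H'G y : face (sext c) y -> H' y = G y.
  by move=> fy; rewrite /H'; case: asboolP => // /(GH _ fy).
exists H' => //; split.
- move=> d; rewrite in_setU1 => /predU1P[->|dD'].
    by apply: tame_on_eq tG => y /H'G.
  apply: tame_on_eq (tH _ dD') => y /face_sext[fy _].
  by rewrite H'H//; exists d.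
- move=> y [d + dy] y0; rewrite in_setU1 => /predU1P[dc|dD'].
    have fy : face (sext c) y by apply/face_sext; rewrite y0 lexx ler01 -dc.
    by rewrite H'G// G0.
  by have Dy : faces D (ini y) by [exists d]; rewrite H'H// H0.
- move=> y [d + dy] y0; rewrite in_setU1 => /predU1P[dc|dD'].
    have fy : face (sext c) y by apply/face_sext; rewrite -dc.
    by rewrite H'G// pG.
  by have Dy : faces D (ini y) by [exists d]; rewrite H'H// pH.
Qed.

(** The homotopy lifting extension property in R^n, for the pair of subcomplexes
    formed by the faces in [S] and in [T]. *)
Lemma local_extension n (S T : {set sig n}) (f : 'rV[R]_n -> E)
    (h : 'rV[R]_n.+1 -> E) (k : 'rV[R]_n.+1 -> B) :
  down_closed S -> down_closed T -> T \subset S ->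
  (forall c, c \in S -> tame_on (face c) f) ->
  (forall c, c \in S -> tame_on (face (sext c)) k) ->
  (forall y, faces S (ini y) -> y 0 ord_max = 0 -> k y = p (f (ini y))) ->
  lift_on T f k h ->
  exists2 H, lift_on S f k H & forall y, faces T (ini y) -> H y = h y.
Proof.
move=> dS dT TS tf tk k0 lh.
pose P (D : {set sig n}) := [/\ T \subset D, D \subset S, down_closed D &
  exists2 H, lift_on D f k H & forall y, faces T (ini y) -> H y = h y].
have PT : `[< P T >] by apply/asboolP; split=> //; exists h.
(* A closed set [D] of maximal cardinality over which a solution extending [h]
   exists; a face of least dimension not in [D] has its boundary in [D]. *)
have [D /asboolP[TD DS dD [H lH Hh]] Dmax] :=
  @arg_maxnP _ T (fun D => `[< P D >]) (fun D => #|D|) PT.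
suff -> : S = D by exists H.
apply/eqP; rewrite finset.eqEsubset DS andbT; apply/negPn/negP.
move=> /fintype.subsetPn[c0 c0S c0D].
have c0P : (c0 \in S) && (c0 \notin D) by rewrite c0S.
have [c /andP[cS cD] cmin] :=
  @arg_minnP _ c0 (fun c => (c \in S) && (c \notin D)) (@free_dim n) c0P.
have cbD i a : c i = None -> set_sig c i a \in D.
  move=> ci; apply: contrapT => /negP nD.
  have := cmin (set_sig c i a); rewrite nD (dS _ _ (set_sig_sub a ci) cS).
  by move=> /(_ erefl); rewrite leqNgt (free_set_sig a ci).
have cDS : c |: D \subset S by rewrite finset.subUset finset.sub1set cS.
have sub d : d \in c |: D -> d \in S by move/fintype.subsetP: cDS; exact.
have [||y [d /sub dS' dy]|H' lH' H'H] := extend_cell dD cD cbD _ _ _ lH.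
- by move=> d /sub/tf.
- by move=> d /sub/tk.
- by apply: k0; exists d.
have : `[< P (c |: D) >].
  apply/asboolP; split=> //.
  - by rewrite (fintype.subset_trans TD)// finset.subsetUr.
  - move=> d e de; rewrite !in_setU1 => /predU1P[ec|eD]; last first.
      by rewrite (dD _ _ de eD) orbT.
    case: eqVneq => //= dc; move: de; rewrite ec => /subsigP de.
    have [i [a [ci di]]] : exists i a, c i = None /\ d i = Some a.
      apply: contrapT => nb; move/eqP: dc; apply; apply/ffunP => i.
      case ci : (c i) => [b|]; first exact: de.
      by case di : (d i) => [a|//]; case: nb; exists i, a.
    apply: dD (cbD i a ci); apply/subsigP => j b; rewrite ffunE.
    by case: eqP => [-> [<-]|_ /de].
  - exists H' => // y Ty; rewrite H'H ?Hh//.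
    by case: Ty => d dT' dy; exists d => //; move/fintype.subsetP: TD; exact.
by move=> /Dmax; rewrite /geq/= cardsU1 cD add1n ltnn.
Qed.

End extension.

(** * Transport through the charts *)

Lemma factor_through (Z W Y : Type) (u : Z -> W) (F : Z -> Y) (y0 : Y) :
  (forall z z', u z = u z' -> F z = F z') -> exists F', forall z, F' (u z) = F z.
Proof.
move=> uF; exists (fun w => if pselect (exists z, u z = w) is left ex
  then F (projT1 (cid ex)) else y0).
move=> z; case: pselect => [ex|[]]; last by exists z.
by apply: uF; exact: projT2 (cid ex).
Qed.

Lemma existT_inj (J : Type) (P : J -> Type) (i : J) (x y : P i) :
  existT P i x = existT P i y -> x = y.
Proof.
move=> e; have := projT2_eq e.
by rewrite (Prop_irrelevance (projT1_eq e) erefl).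
Qed.

(** The face parametrized by [face_map s b]. *)
Definition sig_of_map n d (s : 'I_d -> 'I_n) (b : 'I_n -> bool) : sig n :=
  [ffun i => if fsig s b i is inr a then Some a else None].

Lemma params_sig_of_map n d (s : 'I_d -> 'I_n) b :
  injective s -> params (sig_of_map s b) s b.
Proof.
move=> sI; split=> // [k|i]; rewrite ffunE /fsig.
  by case: pickP => // /(_ k); rewrite eqxx.
by case: pickP => [k /eqP <-|_]; [left; exists k|right].
Qed.

Lemma face_image (R : realType) n (c : sig n) d (s : 'I_d -> 'I_n) b (x : 'rV[R]_n) :
  params c s b -> face c x -> exists2 y, cube R d y & face_map s b y = x.
Proof.
move=> csb cx; exists (cubmap (proj s) x); first exact: cube_cubmap cx.1.
by rewrite face_mapE (fsigK_proj csb cx).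
Qed.

Section assembly.
Variables (R : realType) (E B : diffeologicalType R) (p : E -> B).
Variables (X : cubicalComplex R) (A : set X) (f : X -> E).
Variables (h : A * unit_interval R -> E) (k : X * unit_interval R -> B).
Hypothesis wp : weak_fibration p.
Hypothesis sA : subcomplex A.
Hypothesis tf : tame_map (cells X) f.
Hypothesis th : tame_homotopy (subcells A) h.
Hypothesis tk : tame_homotopy (cells X) k.
Hypothesis h0 : forall a : A, h (a, I0) = f (val a).
Hypothesis k0 : forall x : X, k (x, I0) = p (f x).
Hypothesis ph : forall (a : A) (t : unit_interval R), p (h (a, t)) = k (val a, t).

Section component.
Variable i : comp_index X.
Notation n := (comp_dim i).
Notation K := (@comp_model R X i).

(** The position of a point of the component [i] in the model in R^n. *)
Definition pos (x : Defs.comp i) : 'rV[R]_n := val (comp_chart i x).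

(** The position in R^(n+1) of a point of the cylinder over the component. *)
Definition pos_ext (x : Defs.comp i) (t : unit_interval R) := snoc (pos x) (val t).

Lemma pos_model x : K (pos x).
Proof. exact: set_valP. Qed.

Lemma pos_inj : injective pos.
Proof.
have [_ [g [_ gK _]]] := comp_chartP i.
by move=> x y /val_inj /(congr1 g); rewrite !gK.
Qed.

Lemma pos_surj y : K y -> exists x, pos x = y.
Proof.
move=> Ky; have [_ [g [_ _ gK]]] := comp_chartP i.
by exists (g (SigSub (mem_set Ky))); rewrite /pos gK.
Qed.

Lemma pos_ext_inj x t x' t' : pos_ext x t = pos_ext x' t' -> x = x' /\ t = t'.
Proof.
move=> e; split.
  apply: pos_inj; rewrite -[LHS](ini_snoc _ (val t)) -/(pos_ext _ _) e.
  exact: ini_snoc.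
by apply/val_inj; rewrite -[LHS](last_snoc (pos x)) -/(pos_ext _ _) e last_snoc.
Qed.

(** The faces of the model, and those whose cubes lie in [A]. *)
Definition model_sigs : {set sig n} := [set c : sig n | `[< face c `<=` K >]]%SET.

Definition sub_sigs : {set sig n} :=
  [set c : sig n | `[< face c `<=` K /\
     forall x : Defs.comp i, face c (pos x) -> A (existT _ i x) >]]%SET.

Lemma model_sigsP c : reflect (face c `<=` K) (c \in model_sigs).
Proof. by rewrite inE; exact: asboolP. Qed.

Lemma sub_sigsP c : reflect (face c `<=` K /\
  forall x : Defs.comp i, face c (pos x) -> A (existT _ i x)) (c \in sub_sigs).
Proof. by rewrite inE; exact: asboolP. Qed.

Lemma model_sigs_closed : down_closed model_sigs.
Proof.
by move=> c d /face_sub cd /model_sigsP dK; apply/model_sigsP => x /cd/dK.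
Qed.

Lemma sub_sigs_closed : down_closed sub_sigs.
Proof.
move=> c d /face_sub cd /sub_sigsP[dK dA]; apply/sub_sigsP.
by split=> x /cd; [exact: dK|exact: dA].
Qed.

Lemma sub_sigs_sub : sub_sigs \subset model_sigs.
Proof. by apply/fintype.subsetP => c /sub_sigsP[cK _]; apply/model_sigsP. Qed.

Lemma model_faces x : K x -> faces model_sigs x.
Proof.
have [F [FP KE]] := comp_modelP i; rewrite {1}KE => -[G FG Gx].
have [d [s [b [/homo_ord_inj sI GE]]]] := FP _ FG.
have csb := params_sig_of_map b sI.
exists (sig_of_map s b).
  apply/model_sigsP => y /(face_image csb)[z cz zy].
  by rewrite KE; exists G => //; rewrite GE; exists z.
by move: Gx; rewrite GE => -[z cz <-]; rewrite face_mapE; exact: face_fsig.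
Qed.

(** A face of the model is the position of a cube of [X]. *)
Lemma face_cell c : c \in model_sigs ->
  exists d (s : 'I_d -> 'I_n) b (g : cube R d -> Defs.comp i),
    [/\ params c s b, cells X d (fun t => existT _ i (g t)) &
        forall t, pos (g t) = cubmap (fsig s b) (val t)].
Proof.
move=> /model_sigsP cK; have [d [s [b [hs csb]]]] := params_of_sig c.
have Kt (t : cube R d) : K (cubmap (fsig s b) (val t)).
  by apply: cK; apply: (face_fsig csb); exact: set_valP.
pose g t := projT1 (cid (pos_surj (Kt t))).
have gE t : pos (g t) = cubmap (fsig s b) (val t).
  by exact: projT2 (cid (pos_surj (Kt t))).
exists d, s, b, g; split=> //; exists i, s, b; split=> // t.
by exists (g t) => //; rewrite face_mapE -gE.
Qed.

Lemma cell_sig d (c : cube R d -> X) (s : 'I_d -> 'I_n) b : injective s ->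
  (forall t, exists2 x : Defs.comp i, c t = existT _ i x &
     pos x = face_map s b (val t)) ->
  sig_of_map s b \in model_sigs.
Proof.
move=> sI cs; apply/model_sigsP => y /(face_image (params_sig_of_map b sI))[z cz <-].
have [x _ /= <-] := cs (SigSub (mem_set cz)); exact: pos_model.
Qed.

Lemma sub_faces x : A (existT _ i x) -> faces sub_sigs (pos x).
Proof.
have [F [FP AE]] := sA; rewrite {1}AE => -[G FG Gx].
have [d [c [[j [s [b [/homo_ord_inj sI cs]]]] GE]]] := FP _ FG.
move: Gx; rewrite GE => -[t _ ct].
have [x' ct' x't] := cs t.
have ij : j = i by have := congr1 (@projT1 _ _) (etrans (esym ct') ct).
subst j; have xx' : x' = x by exact: existT_inj (etrans (esym ct') ct).
subst x'; have csb := params_sig_of_map b sI.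
exists (sig_of_map s b); last first.
  by rewrite /pos x't face_mapE; apply: (face_fsig csb); exact: set_valP.
apply/sub_sigsP; split; first exact/model_sigsP/(cell_sig sI cs).
move=> y /(face_image csb)[z cz zy].
have [y' cy' y'z] := cs (SigSub (mem_set cz)).
have -> : y = y' by apply: pos_inj; rewrite -zy; exact/esym.
by rewrite AE; exists G => //; rewrite GE -cy'; exists (SigSub (mem_set cz)).
Qed.

(** The solution on one component.  The point [x0] supplies a value in [E] for
    the arguments outside the model. *)
Lemma component_lift (x0 : Defs.comp i) : exists H : 'rV[R]_n.+1 -> E,
  [/\ forall c, c \in model_sigs -> tame_on (face (sext c)) H,
      forall x, H (pos_ext x I0) = f (existT _ i x),
      forall (a : A) x t, val a = existT _ i x -> H (pos_ext x t) = h (a, t) &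
      forall x t, p (H (pos_ext x t)) = k (existT _ i x, t)].
Proof.
pose e0 := f (existT _ i x0).
(* [f'], [k'] and [h'] express [f], [k] and [h] in terms of positions. *)
have [f' f'E] : exists f', forall x, f' (pos x) = f (existT _ i x).
  by apply: factor_through e0 _ => x y /pos_inj ->.
have [k' k'E] : exists k', forall z : Defs.comp i * unit_interval R,
    k' (pos_ext z.1 z.2) = k (existT _ i z.1, z.2).
  by apply: factor_through (p e0) _ => -[x t] [y r] /pos_ext_inj[/= -> ->].
have [h' h'E] : exists h', forall z : {z : A * Defs.comp i * unit_interval R |
    val z.1.1 = existT _ i z.1.2},
    h' (pos_ext (sval z).1.2 (sval z).2) = h ((sval z).1.1, (sval z).2).
  apply: factor_through e0 _.
  move=> -[[[a x] t] /= ax] [[[b y] r] /= by_] /pos_ext_inj[/= xy ->].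
  by congr (h (_, _)); apply/val_inj; apply: etrans ax (etrans _ (esym by_)); rewrite xy.
have {}h'E (a : A) x t : val a = existT _ i x -> h' (pos_ext x t) = h (a, t).
  by move=> ax; exact: (h'E (exist _ (a, x, t) ax)).
have pos_extE (y : 'rV[R]_n.+1) : K (ini y) -> forall yI : unit_interval R (y 0 ord_max),
    exists x, ini y = pos x /\ y = pos_ext x (SigSub (mem_set yI)).
  move=> /pos_surj[x xy] yI; exists x; split=> //.
  by rewrite /pos_ext xy /= snoc_ini.
have I0E (y : 'rV[R]_n.+1) : K (ini y) -> y 0 ord_max = 0 ->
    exists x, ini y = pos x /\ y = pos_ext x I0.
  move=> /pos_surj[x xy] y0; exists x; split=> //.
  by rewrite /pos_ext xy /= -y0 snoc_ini.
have KS y : faces model_sigs y -> K y by move=> [c /model_sigsP]; exact.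
have AT y : faces sub_sigs y -> K y by move=> [c /sub_sigsP[cK _]]; exact: cK.
have AA x : faces sub_sigs (pos x) -> A (existT _ i x).
  by move=> [c /sub_sigsP[_ cA]]; exact: cA.
have [||y Sy y0||H [tH H0 pH] Hh] := local_extension (f := f') (k := k') (h := h') wp
  model_sigs_closed sub_sigs_closed sub_sigs_sub.
- move=> c /face_cell[d [s [b [g [csb cg gE]]]]].
  apply/(tame_on_params csb); apply/(tameP (F := f \o (fun t => existT _ i (g t)))).
    by move=> z /=; rewrite -gE f'E.
  exact: tf.2.
- move=> c /face_cell[d [s [b [g [csb cg gE]]]]].
  apply/(tame_on_params_ext csb).
  have [_ _ _ /(_ _ _ cg) tc] := tk.
  apply: (proj1 (tameP _) tc) => z /=; rewrite -(k'E (_, _)); congr k'.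
  by apply: row_lastP; rewrite ?ini_snoc ?last_snoc ?ini_cext ?last_cext ?gE.
- have [x [-> ->]] := I0E _ (KS _ Sy) y0.
  by rewrite (k'E (_, _)) k0 f'E.
- split=> [c cT|y Ty y0|y Ty yI].
  + have /face_cell[d [s [b [g [csb cg gE]]]]] : c \in model_sigs.
      by move/fintype.subsetP: sub_sigs_sub; exact.
    have Ag t : A (existT _ i (g t)).
      case/sub_sigsP: cT => _; apply; rewrite gE; apply: (face_fsig csb); exact: set_valP.
    apply/(tame_on_params_ext csb).
    have [_ _ _ /(_ d (fun t => SigSub (mem_set (Ag t)) : A) cg) tc] := th.
    apply: (proj1 (tameP _) tc) => z /=; rewrite -(h'E _ (g (cube_init z))) //; congr h'.
    by apply: row_lastP; rewrite ?ini_snoc ?last_snoc ?ini_cext ?last_cext ?gE.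
  + have [x [yx ->]] := I0E _ (AT _ Ty) y0.
    have Ax : A (existT _ i x) by apply: AA; rewrite -yx.
    by rewrite (h'E (SigSub (mem_set Ax)))// h0 /= ini_snoc f'E.
  + have [x [yx ->]] := pos_extE _ (AT _ Ty) yI.
    have Ax : A (existT _ i x) by apply: AA; rewrite -yx.
    by rewrite (h'E (SigSub (mem_set Ax)))// ph (k'E (_, _)).
exists H; split=> // [x|a x t ax|x t].
- rewrite H0 ?ini_snoc ?last_snoc//; exact/model_faces/pos_model.
- rewrite Hh ?ini_snoc ?last_snoc//; first exact: h'E.
  by apply: sub_faces; rewrite -ax; exact: set_valP.
- rewrite pH ?ini_snoc ?last_snoc ?(k'E (_, _))//; first exact/model_faces/pos_model.
  exact: (set_valP t).
Qed.

End component.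

End assembly.

(** * Assembling the components *)

Lemma plot_snoc (R : realType) m (U : set 'rV[R]_m) n (q : 'rV[R]_m -> 'rV[R]_n)
    (r : 'rV[R]_m -> R) : plot U q -> plot U r -> plot U (fun x => snoc (q x) (r x)).
Proof.
move=> pq pr; have oU := plot_open pq; apply/plot_rV => // i.
case: (unliftP ord_max i) => [j|] ->.
  by apply: plot_eq ((plot_rV q oU).1 pq j) => x _ /=; rewrite mxE liftK.
by apply: plot_eq pr => x _ /=; rewrite last_snoc.
Qed.

(** [cubmap (@top_end n)] is the inclusion of R^n at height 1 in R^(n+1). *)
Definition top_end n (i : 'I_n.+1) : 'I_n + bool :=
  if unlift ord_max i is Some j then inl j else inr true.

Lemma coord_inj_top_end n : coord_inj (@top_end n).
Proof.
move=> i i' l; rewrite /top_end.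
case: (unliftP ord_max i) => [j ->|//]; case: (unliftP ord_max i') => [j' ->|//].
by move=> [->] [->].
Qed.

Lemma cubmap_top_end (R : realType) n (x : 'rV[R]_n) : cubmap (@top_end n) x = snoc x 1.
Proof. by apply/rowP => i; rewrite !mxE /top_end; case: unlift. Qed.

(** Maps on the cylinders over the components that are tame in terms of positions
    form a tame homotopy, as soon as the initial map is tame. *)
Section conclusion.
Variables (R : realType) (E : diffeologicalType R) (X : cubicalComplex R).
Variable G : forall i : comp_index X, Defs.comp i -> unit_interval R -> E.
Hypothesis GP : forall i (x0 : Defs.comp i), exists2 H,
  (forall c, c \in model_sigs i -> tame_on (face (sext c)) H) &
  forall x t, G x t = H (pos_ext x t).

(** The map on the cylinder over the disjoint union. *)
Definition assembled (z : X * unit_interval R) : E := G (projT2 z.1) z.2.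

Lemma smooth_assembled : smooth assembled.
Proof.
move=> m U q [/= p1 p2]; apply: plot_local; first exact: plot_open p1.
move=> x Ux; have [_ /(_ x Ux)[V [i [r [Vx VU pr qr]]]]] := p1.
exists V; split=> //; have [H tH GH] := GP (r x).
have oV := plot_open pr.
have p2V : plot V (fun y => (q y).2).
  by apply: (plot_comp p2 oV (fun l => Ck_id l V)) => y; exact: VU.
apply: (@plot_eq _ _ _ _ (fun y => H (pos_ext (r y) (q y).2))).
  by move=> y Vy; rewrite -GH /= /assembled qr.
have sH : smooth_on (faces (@sext _ @: model_sigs i)%SET) H.
  apply: (tame_on_faces _).1 => c /imsetP[d dS ->]; exact: tH.
apply: sH.
  apply: plot_snoc; last exact: p2V.
  have [sc _] := comp_chartP i; exact: (sc _ _ _ pr).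
move=> y Vy; have [c cS cy] := model_faces (pos_model (r y)).
exists (sext c); first exact: imset_f.
by apply/face_sext; rewrite ini_snoc last_snoc; split=> //; exact: (set_valP (q y).2).
Qed.

Lemma assembled_cell d (c : cube R d -> X) : cells X d c ->
  exists n (e : sig n) (s : 'I_d -> 'I_n) b (H : 'rV[R]_n.+1 -> E),
    [/\ params e s b, tame_on (face (sext e)) H &
      forall t r, assembled (c t, r) = H (snoc (cubmap (fsig s b) (val t)) (val r))].
Proof.
move=> [i [s [b [/homo_ord_inj sI cs]]]].
have [x0 _ _] := cs (SigSub (mem_set (@cube0 R d))).
have [H tH GH] := GP x0.
exists (comp_dim i), (sig_of_map s b), s, b, H; split.
- exact: params_sig_of_map.
- exact/tH/(cell_sig sI cs).
- move=> t r; have [x ct xt] := cs t.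
  by rewrite /assembled ct /= GH /pos_ext /pos xt face_mapE.
Qed.

Lemma tame_assembled : tame_map (cells X) (fun x => assembled (x, I0)) ->
  tame_homotopy (cells X) assembled.
Proof.
move=> t0; split=> //; first exact: smooth_assembled.
  split=> [m U q pq|d c /assembled_cell[n [e [s [b [H [esb tH cH]]]]]]].
    apply: (smooth_assembled (p := fun y => (q y, I1))).
    by split=> //=; apply: plot_cst; exact: plot_open pq.
  have top (y : 'rV[R]_n) : face e y -> face (sext e) (cubmap (@top_end n) y).
    by move=> ey; apply/face_sext; rewrite cubmap_top_end ini_snoc last_snoc ler01 lexx.
  have tt := tame_on_cubmap (@coord_inj_top_end n) top tH.
  apply: (proj2 (tameP _) ((tame_on_params esb _).1 tt)) => z /=.
  by rewrite cH cubmap_top_end.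
move=> d c /assembled_cell[n [e [s [b [H [esb tH cH]]]]]].
apply: (proj2 (tameP _) ((tame_on_params_ext esb _).1 tH)) => z /=.
rewrite cH; congr H.
by apply: row_lastP; rewrite ?ini_snoc ?last_snoc ?ini_cext ?last_cext.
Qed.

End conclusion.

Unset Implicit Arguments.
Theorem theorem4p5 (R : realType) (E B : diffeologicalType R) (p : E -> B)
    (X : cubicalComplex R) (A : set X) (f : X -> E)
    (h : A * unit_interval R -> E) (k : X * unit_interval R -> B) :
  weak_fibration p -> subcomplex A ->
  tame_map (cells X) f ->
  tame_homotopy (subcells A) h ->
  tame_homotopy (cells X) k ->
  (forall a : A, h (a, I0) = f (val a)) ->
  (forall x : X, k (x, I0) = p (f x)) ->
  (forall (a : A) (t : unit_interval R), p (h (a, t)) = k (val a, t)) ->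
  exists H : X * unit_interval R -> E,
    [/\ tame_homotopy (cells X) H,
        forall x : X, H (x, I0) = f x,
        forall (a : A) (t : unit_interval R), H (val a, t) = h (a, t) &
        forall (x : X) (t : unit_interval R), p (H (x, t)) = k (x, t)].
Proof.
move=> wp sA tf th tk h0 k0 ph.
(* For an empty component a total function on R^n with values in [E] need not
   exist, so the choice is that of a map [G] on the cylinder over the component. *)
have cl i : exists G : Defs.comp i -> unit_interval R -> E,
    forall x0 : Defs.comp i, exists2 H,
      [/\ forall c, c \in model_sigs i -> tame_on (face (sext c)) H,
      forall x, H (pos_ext x I0) = f (existT _ i x),
      forall (a : A) x t, val a = existT _ i x -> H (pos_ext x t) = h (a, t) &
      forall x t, p (H (pos_ext x t)) = k (existT _ i x, t)] &
      forall x t, G x t = H (pos_ext x t).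
  have [[x0]|nx] := pselect (inhabited (Defs.comp i)); last first.
    by exists (fun x => False_rect _ (nx (inhabits x))) => x0; case: nx.
  have [H HP] := component_lift wp sA tf th tk h0 k0 ph x0.
  by exists (fun x t => H (pos_ext x t)) => _; exists H.
pose G i := projT1 (cid (cl i)).
have GP i := projT2 (cid (cl i)).
have G0 x : assembled G (x, I0) = f x.
  case: x => i x; have [H [_ H0 _ _] GH] := GP i x.
  by rewrite -H0; exact: GH.
exists (assembled G); split=> //.
- apply: tame_assembled.
    by move=> i x0; have [H [tH _ _ _] GH] := GP i x0; exists H.
  rewrite (_ : (fun x => _) = f)//; exact/funext.
- move=> a t; case ax : (val a) => [i x]; have [H [_ _ Hh _] GH] := GP i x.
  by rewrite -(Hh a x t ax); exact: GH.
- move=> [i x] t; have [H [_ _ _ pH] GH] := GP i x.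
  by rewrite -pH; congr p; exact: GH.
Qed.
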